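(* Let $M$ be a complete metric space and let $\mu\in S_{\mathcal{F}(M)}$. Then the following are equivalent: (i) $\mu\in\mathrm{SCD}(B_{\mathcal{F}(M)})$; (ii) $\mu\in\overline{\mathrm{conv}}\bigl(\mathrm{dent}(B_{\mathcal{F}(M)})\bigr)$. In particular, if $M$ is separable, then $B_{\mathcal{F}(M)}$ is an SCD set if and only if $B_{\mathcal{F}(M)}=\overline{\mathrm{conv}}\bigl(\mathrm{dent}(B_{\mathcal{F}(M)})\bigr)$.
   Context: $B_X$, $S_X$, $X^*$ denote the closed unit ball, the unit sphere and the topological dual of a Banach space $X$. A slice of a bounded set $A\subseteq X$ is a non-empty intersection of $A$ with an open half-space; it can be written as $S(A,x^*,\alpha)=\{x\in A:\operatorname{Re}x^*(x)>\sup_{b\in A}\operatorname{Re}x^*(b)-\alpha\}$ with $x^*\in X^*$, $\alpha>0$. Let $A\subseteq X$ be bounded and convex and $a\in A$. A countable collection $\{V_n:n\in\mathbb{N}\}$ of non-empty subsets of $A$ is determining for $a$ if $a\in\overline{\mathrm{conv}}(B)$ whenever $B\subseteq A$ intersects all the sets $V_n$. The point $a$ is an SCD point (slicely countably determined point) of $A$ if there is a sequence of slices of $A$ that is determining for $a$; $\mathrm{SCD}(A)$ is the set of all SCD points of $A$. The set $A$ is an SCD set if there is a sequence $\{S_n:n\in\mathbb{N}\}$ of slices of $A$ such that $A\subseteq\overline{\mathrm{conv}}(B)$ whenever $B\subseteq A$ intersects all the $S_n$. A point $x\in A$ is a denting point of $A$ if for every $\varepsilon>0$ there is a slice $S$ of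 $A$ with $x\in S$ and $\mathrm{diam}(S)\le\varepsilon$; $\mathrm{dent}(A)$ is the set of denting points of $A$. For a metric space $(M,d)$ with a fixed point $0\in M$, $\mathrm{Lip}_0(M)$ is the real Banach space of all Lipschitz functions $f:M\to\mathbb{R}$ with $f(0)=0$, with norm $\|f\|=\sup\{|f(x)-f(y)|/d(x,y):x\neq y\in M\}$. For $x\in M$, $\delta_x\in\mathrm{Lip}_0(M)^*$ is given by $\delta_x(f)=f(x)$. The Lipschitz-free space $\mathcal{F}(M)$ is the norm-closed linear span of $\{\delta_x:x\in M\}$ in $\mathrm{Lip}_0(M)^*$. *)

(* Defs.v *)
From HB Require Import structures.
From mathcomp Require Import all_boot all_order all_algebra.
From mathcomp Require Import all_classical all_reals all_analysis.

Set Implicit Arguments.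
Unset Strict Implicit.
Unset Printing Implicit Defensive.

Import Order.TTheory GRing.Theory Num.Theory.
Import numFieldNormedType.Exports.

Local Open Scope classical_set_scope.
Local Open Scope ring_scope.

Definition dual_pred (R : realType) (X : normedModType R) : {pred X -> R} :=
  fun f => `[< linear (f : X -> R) /\ continuous (f : X -> R) >].

Record dual (R : realType) (X : normedModType R) := Dual {
  dual_val :> X -> R ;
  dual_valP : dual_val \in @dual_pred R X }.

Section dual_lmod.
Context (R : realType) (X : normedModType R).

HB.instance Definition _ := [isSub for @dual_val R X].
HB.instance Definition _ := [Choice of dual X by <:].

Lemma dual_submod : submod_closed (@dual_pred R X).
Proof.
split.
  apply/asboolP; split; last exact: cst_continuous.
  move=> a u v; suff : 0 = a *: 0 + 0 :> R by [].
  by rewrite scaler0 addr0.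
move=> a f g /asboolP[lf cf] /asboolP[lg cg]; apply/asboolP; split.
  move=> b u v.
  suff : a *: f (b *: u + v) + g (b *: u + v) =
         b *: (a *: f u + g u) + (a *: f v + g v) by [].
  by rewrite lf lg !scalerDr !scalerA (mulrC a b) addrACA.
move=> x; apply: cvgD; last exact: cg.
exact: cvgZr (cf x).
Qed.

HB.instance Definition _ :=
  GRing.isSubmodClosed.Build R _ (@dual_pred R X) dual_submod.
HB.instance Definition _ := [SubChoice_isSubLmodule of dual X by <:].

Lemma dual_linear (f : dual X) : linear (f : X -> R).
Proof. by have /asboolP[] := dual_valP f. Qed.

HB.instance Definition _ (f : dual X) :=
  GRing.isLinear.Build R X R *:%R f (dual_linear f).

Lemma dual_continuous (f : dual X) : continuous (f : X -> R).
Proof. by have /asboolP[] := dual_valP f. Qed.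

Definition dual_norm (f : dual X) : R :=
  sup [set `|f x| | x in [set x : X | `|x| <= 1]].

Lemma dual_has_sup (f : dual X) :
  has_sup [set `|f x| | x in [set x : X | `|x| <= 1]].
Proof.
split; first by exists `|f 0|, 0 => //=; rewrite normr0.
have /linear_boundedP/pinfty_ex_gt0[r r0 fr] :=
  continuous_linear_bounded 0 (@dual_continuous f 0).
exists r => _ [x /= x1 <-]; rewrite (le_trans (fr x))//.
by rewrite -[leRHS]mulr1 ler_wpM2l// ltW.
Qed.

Lemma dual_norm_ge (f : dual X) x : `|x| <= 1 -> `|f x| <= dual_norm f.
Proof.
by move=> x1; apply: sup_upper_bound; [exact: dual_has_sup|exists x].
Qed.

Lemma dual_norm_le (f : dual X) (c : R) :
  (forall x, `|x| <= 1 -> `|f x| <= c) -> dual_norm f <= c.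
Proof.
move=> fc; apply: ge_sup; first by case: (dual_has_sup f).
by move=> _ [x /= x1 <-]; exact: fc.
Qed.

Lemma dual_norm_ge0 (f : dual X) : 0 <= dual_norm f.
Proof. by rewrite (le_trans _ (@dual_norm_ge f 0 _)) ?normr0. Qed.

Lemma dual_normD (f g : dual X) :
  dual_norm (f + g) <= dual_norm f + dual_norm g.
Proof.
apply: dual_norm_le => x x1; rewrite (le_trans (ler_normD _ _))//.
by rewrite lerD// dual_norm_ge.
Qed.

Let dual_normZ_le (a : R) (f : dual X) :
  dual_norm (a *: f) <= `|a| * dual_norm f.
Proof.
by apply: dual_norm_le => x x1; rewrite normrZ ler_wpM2l// dual_norm_ge.
Qed.

Lemma dual_normZ (a : R) (f : dual X) :
  dual_norm (a *: f) = `|a| * dual_norm f.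
Proof.
apply/eqP; rewrite eq_le dual_normZ_le/=.
have [->|a0] := eqVneq a 0; first by rewrite normr0 mul0r dual_norm_ge0.
rewrite -ler_pdivlMl ?normr_gt0// -normfV.
by rewrite (le_trans _ (dual_normZ_le _ _))// scalerA mulVf// scale1r.
Qed.

Lemma dual_norm0_eq0 (f : dual X) : dual_norm f = 0 -> f = 0.
Proof.
move=> f0; apply/val_inj/funext => x /=; apply/eqP.
have [->|x0] := eqVneq x 0; first by rewrite linear0.
have : `|f (`|x|^-1 *: x)| <= 0.
  by rewrite -f0 dual_norm_ge// normrZ normfV normr_id mulVf ?normr_eq0.
by rewrite normr_le0 linearZ/= scaler_eq0 invr_eq0 normr_eq0 (negbTE x0).
Qed.

HB.instance Definition _ :=
  Lmodule_isNormed.Build R (dual X) dual_normD dual_normZ dual_norm0_eq0.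

End dual_lmod.

Section SCD.
Context (R : realType) (X : normedModType R).
Implicit Types (A B S : set X) (a x : X).

Definition unit_ball : set X := [set x | `|x| <= 1].

Definition unit_sphere : set X := [set x | `|x| = 1].

Definition closed_conv B : set X :=
  closure (smallest (@convex_set R X) B : set X).

(* [sup] is the actual supremum only when [A] is bounded and nonempty;
   scalars are real, so no real part is taken. *)
Definition slice A (f : dual X) (alpha : R) : set X :=
  [set x | A x /\ sup [set f b | b in A] - alpha < f x].

Definition is_slice A S :=
  S !=set0 /\ exists f : dual X, exists2 alpha : R, 0 < alpha &
    S = slice A f alpha.

Definition determining A (V : nat -> set X) a :=
  (forall n, V n !=set0 /\ V n `<=` A) /\
  (forall B, B `<=` A -> (forall n, B `&` V n !=set0) -> closed_conv B a).

Definition SCD_points A : set X :=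
  [set a | A a /\ exists S : nat -> set X,
    (forall n, is_slice A (S n)) /\ determining A S a].

Definition SCD_set A :=
  exists S : nat -> set X, (forall n, is_slice A (S n)) /\
    (forall B, B `<=` A -> (forall n, B `&` S n !=set0) ->
      A `<=` closed_conv B).

Definition diam S : \bar R :=
  ereal_sup [set (`|z.1 - z.2|)%:E | z in S `*` S].

Definition dent A : set X :=
  [set x | A x /\ forall eps : R, 0 < eps ->
    exists S, [/\ is_slice A S, S x & (diam S <= eps%:E)%E]].

End SCD.

Arguments unit_ball {R} X.
Arguments unit_sphere {R} X.

Definition lip0_pred (R : realType) (M : metricType R) (x0 : M) :
    {pred M -> R} :=
  fun f => `[< f x0 = 0 /\
    exists k : R, forall x y, `|f x - f y| <= k * mdist x y >].

Record Lip0 (R : realType) (M : metricType R) (x0 : M) := MkLip0 {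
  lip0_val :> M -> R ;
  lip0_valP : lip0_val \in lip0_pred x0 }.

Section Lip0_normed.
Context (R : realType) (M : metricType R) (x0 : M).

HB.instance Definition _ := [isSub for @lip0_val R M x0].
HB.instance Definition _ := [Choice of Lip0 x0 by <:].

Lemma lip0_submod : submod_closed (lip0_pred x0).
Proof.
split.
  apply/asboolP; split => //; exists 0 => x y.
  suff : `|0 - 0 : R| <= 0 * mdist x y by [].
  by rewrite subrr normr0 mul0r.
move=> a f g /asboolP[f0 [k fk]] /asboolP[g0 [l gl]]; apply/asboolP; split.
  suff : a *: f x0 + g x0 = 0 by [].
  by rewrite f0 g0 scaler0 addr0.
exists (`|a| * k + l) => x y.
suff : `|(a *: f x + g x) - (a *: f y + g y)| <= (`|a| * k + l) * mdist x y.
  by [].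
rewrite opprD addrACA -scalerBr.
rewrite (le_trans (ler_normD _ _))// normrZ mulrDl lerD// -mulrA.
by rewrite ler_wpM2l.
Qed.

HB.instance Definition _ :=
  GRing.isSubmodClosed.Build R _ (lip0_pred x0) lip0_submod.
HB.instance Definition _ := [SubChoice_isSubLmodule of Lip0 x0 by <:].

Lemma lip0_base (f : Lip0 x0) : f x0 = 0.
Proof. by have /asboolP[] := lip0_valP f. Qed.

(* On a one-point [M] the set is empty and its [sup] is 0. *)
Definition lip0_norm (f : Lip0 x0) : R :=
  sup [set `|f z.1 - f z.2| / mdist z.1 z.2 | z in [set z : M * M | z.1 != z.2]].

Lemma lip0_norm_ge (f : Lip0 x0) x y :
  `|f x - f y| <= lip0_norm f * mdist x y.
Proof.
have [->|xy] := eqVneq x y; first by rewrite subrr normr0 mdistxx mulr0.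
rewrite -ler_pdivrMr ?mdist_gt0//; apply: sup_upper_bound; last first.
  by exists (x, y).
split; first by exists (`|f x - f y| / mdist x y), (x, y).
have /asboolP[_ [k fk]] := lip0_valP f.
by exists k => _ [[u v]/= uv <-]; rewrite ler_pdivrMr ?mdist_gt0.
Qed.

Lemma lip0_norm_le (f : Lip0 x0) (c : R) : 0 <= c ->
  (forall x y, `|f x - f y| <= c * mdist x y) -> lip0_norm f <= c.
Proof.
move=> c0 fc; rewrite /lip0_norm; set S := (X in sup X).
have [->|/set0P S0] := eqVneq S set0; first by rewrite sup0.
apply: ge_sup => //.
by move=> _ [[u v]/= uv <-]; rewrite ler_pdivrMr ?mdist_gt0.
Qed.

Lemma lip0_norm_ge0 (f : Lip0 x0) : 0 <= lip0_norm f.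
Proof.
have [[[u v] /= uv]|S0] := pselect ([set z : M * M | z.1 != z.2] !=set0).
  rewrite -(pmulr_lge0 _ (_ : 0 < mdist u v)) ?mdist_gt0//.
  by rewrite (le_trans _ (lip0_norm_ge f u v)).
rewrite /lip0_norm (_ : [set z | _] = set0) ?image_set0 ?sup0//.
by apply/seteqP; split => // z z12; case: S0; exists z.
Qed.

Lemma lip0_normD (f g : Lip0 x0) :
  lip0_norm (f + g) <= lip0_norm f + lip0_norm g.
Proof.
apply: lip0_norm_le; first by rewrite addr_ge0// lip0_norm_ge0.
move=> x y; suff : `|(f x + g x) - (f y + g y)| <=
    (lip0_norm f + lip0_norm g) * mdist x y by [].
rewrite opprD addrACA (le_trans (ler_normD _ _))//.
by rewrite mulrDl lerD// lip0_norm_ge.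
Qed.

Let lip0_normZ_le (a : R) (f : Lip0 x0) :
  lip0_norm (a *: f) <= `|a| * lip0_norm f.
Proof.
apply: lip0_norm_le; first by rewrite mulr_ge0// lip0_norm_ge0.
move=> x y; suff : `|a *: f x - a *: f y| <=
    `|a| * lip0_norm f * mdist x y by [].
rewrite -scalerBr normrZ -mulrA.
by rewrite ler_wpM2l// lip0_norm_ge.
Qed.

Lemma lip0_normZ (a : R) (f : Lip0 x0) :
  lip0_norm (a *: f) = `|a| * lip0_norm f.
Proof.
apply/eqP; rewrite eq_le lip0_normZ_le/=.
have [->|a0] := eqVneq a 0; first by rewrite normr0 mul0r lip0_norm_ge0.
rewrite -ler_pdivlMl ?normr_gt0// -normfV.
by rewrite (le_trans _ (lip0_normZ_le _ _))// scalerA mulVf// scale1r.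
Qed.

Lemma lip0_norm0_eq0 (f : Lip0 x0) : lip0_norm f = 0 -> f = 0.
Proof.
move=> f0; apply/val_inj/funext => x /=; apply/eqP.
have := lip0_norm_ge f x x0.
by rewrite f0 mul0r lip0_base subr0 normr_le0.
Qed.

HB.instance Definition _ :=
  Lmodule_isNormed.Build R (Lip0 x0) lip0_normD lip0_normZ lip0_norm0_eq0.

Lemma delta_subproof (x : M) :
  (fun f : Lip0 x0 => f x) \in @dual_pred R (Lip0 x0).
Proof.
apply/asboolP; split=> [//|f].
apply/(@cvgrPdist_lt _ _ _ (nbhs f)) => e e0.
have d0 : 0 < mdist x x0 + 1 by rewrite ltr_wpDl// mdist_ge0.
apply/nbhs_ballP; exists (e / (mdist x x0 + 1)); first exact: divr_gt0.
move=> g; rewrite -ball_normE /= ltr_pdivlMr// => fg.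
have <- : (f - g) x - (f - g) x0 = f x - g x.
  by rewrite (lip0_base (f - g)) subr0.
rewrite (le_lt_trans (lip0_norm_ge _ _ _))// (le_lt_trans _ fg)//.
by rewrite ler_wpM2l ?lip0_norm_ge0// lerDl.
Qed.

Definition delta (x : M) : dual (Lip0 x0) := Dual (delta_subproof x).

End Lip0_normed.

Definition lin_span (R : realType) (V : lmodType R) (S : set V) : set V :=
  smallest [set A : set V | A 0 /\
    forall (a : R) u v, A u -> A v -> A (a *: u + v)] S.

Definition free_pred (R : realType) (M : metricType R) (x0 : M) :
    {pred dual (Lip0 x0)} :=
  fun mu => `[< closure (lin_span (range (@delta R M x0))) mu >].

Arguments free_pred {R M} x0.

Record Free (R : realType) (M : metricType R) (x0 : M) := MkFree {
  free_val :> dual (Lip0 x0) ;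
  free_valP : free_val \in free_pred x0 }.

Section Free_normed.
Context (R : realType) (M : metricType R) (x0 : M).

HB.instance Definition _ := [isSub for @free_val R M x0].
HB.instance Definition _ := [Choice of Free x0 by <:].

Lemma lin_span0 (V : lmodType R) (S : set V) : lin_span S 0.
Proof. by move=> A [[]]. Qed.

Lemma lin_spanP (V : lmodType R) (S : set V) (a : R) u v :
  lin_span S u -> lin_span S v -> lin_span S (a *: u + v).
Proof. by move=> Su Sv A AS; apply: (AS.1).2; [exact: Su|exact: Sv]. Qed.

Lemma free_submod : submod_closed (free_pred x0).
Proof.
split; first by apply/asboolP; apply: subset_closure; exact: lin_span0.
move=> a mu nu /asboolP cmu /asboolP cnu; apply/asboolP.
have cont : continuous
    (fun p : dual (Lip0 x0) * dual (Lip0 x0) => a *: p.1 + p.2).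
  move=> p; apply: cvgD; last exact: cvg_snd.
  by apply: cvgZr; exact: cvg_fst.
move=> U /(cont (mu, nu))[[P Q] /= [Pmu Qnu] PQU].
have [u [Su Pu]] := cmu _ Pmu.
have [v [Sv Qv]] := cnu _ Qnu.
by exists (a *: u + v); split; [exact: lin_spanP|exact: (PQU (u, v))].
Qed.

HB.instance Definition _ :=
  GRing.isSubmodClosed.Build R _ (free_pred x0) free_submod.
HB.instance Definition _ := [SubChoice_isSubLmodule of Free x0 by <:].

Definition free_norm (mu : Free x0) : R := `|free_val mu|.

Lemma free_normD (mu nu : Free x0) :
  free_norm (mu + nu) <= free_norm mu + free_norm nu.
Proof. exact: ler_normD. Qed.

Lemma free_normZ (a : R) (mu : Free x0) :
  free_norm (a *: mu) = `|a| * free_norm mu.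
Proof. exact: normrZ. Qed.

Lemma free_norm0_eq0 (mu : Free x0) : free_norm mu = 0 -> mu = 0.
Proof. by move=> /normr0_eq0 mu0; exact: val_inj. Qed.

HB.instance Definition _ :=
  Lmodule_isNormed.Build R (Free x0) free_normD free_normZ free_norm0_eq0.

End Free_normed.

(* The library's [Complete] structure additionally requires a pointed type. *)
Definition complete_space (M : uniformType) :=
  forall F : set_system M, ProperFilter F -> cauchy F -> exists l : M, F --> l.

Definition separable_space (M : topologicalType) :=
  exists D : set M, countable D /\ dense D.

(* Main.v *)
Require Import Defs.
From HB Require Import structures.
From mathcomp Require Import all_boot all_order all_algebra.
From mathcomp Require Import all_classical all_reals all_analysis.
From mathcomp Require Import ring lra.

Set Implicit Arguments.
Unset Strict Implicit.
Unset Printing Implicit Defensive.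

Import Order.TTheory GRing.Theory Num.Theory.
Import numFieldNormedType.Exports.

Local Open Scope classical_set_scope.
Local Open Scope ring_scope.

(** Every denting point is an SCD point, and the SCD points of the ball form a
closed convex set; this gives one implication on the sphere, and in the
separable case it gives the same implication for the whole ball, because one
sequence of slices then serves a dense sequence of denting points.

For the converse, write m(u, v) for the molecule of u and v, that is, the
difference of the point evaluations at u and v divided by their distance.  The
dual of the free space consists of the Lipschitz functions, and a functional f
takes at m(u, v) the slope of f between u and v.  The proof rests on two facts.

1. A slice of the ball contains a denting point or molecules m(u, v) with u and v
as close as desired ([slice_dichotomy]).  If the slice, given by f and a
threshold c, has no short molecules, a pair with slope above c may be replaced by
shorter ones, by inserting intermediate points, without lowering the slope much.
By completeness, in the form of Ekeland's principle, this process has a terminal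
pair x, y, with almost no points metrically between x and y
([isolated_steep_pair]).  For such a pair there is a function whose slope is
almost maximal only between the vicinities of x and y ([peak_function]), and its
slices show that m(x, y) is denting ([denting_molecule]).

2. Short molecules cannot help to approximate a point of norm 1.  If the pairs
(u_n, v_n) have very small total length, then every 1-Lipschitz function has a
uniformly close 1-Lipschitz function that vanishes at the first N of the
m(u_n, v_n), with a bound on the distance that does not depend on N
([flatten_pairs]).  Applied to a function that almost norms mu, this shows that a
convex combination of such molecules and of denting points that is close to mu
puts almost all its weight on the denting points ([SCD_sphere_dent]).

Given a determining sequence of slices for mu, choose in each slice a denting
point or a very short molecule; mu lies in the closed convex hull of the choices,
hence by the second fact in that of the denting points.  Finally, the ball is
the convex hull of the sphere, unless the space is trivial, in which case 0 is
denting; this yields the statement on SCD sets. *)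

(** * Convex hulls and slices *)

Lemma exists_natSinv_lt (R : realType) (e : R) : 0 < e ->
  exists n : nat, n.+1%:R^-1 < e.
Proof.
move=> e0; exists (Num.truncn e^-1).
by rewrite invf_plt ?posrE ?ltr0n//; exact: truncnS_gt.
Qed.

Section convex_hulls.
Context (R : realType) (X : normedModType R).
Implicit Types (A B C : set X) (x y : X).

Lemma closure_normP A x :
  closure A x <-> forall e : R, 0 < e -> exists2 a, A a & `|x - a| < e.
Proof.
split=> [cA e e0|H B /nbhs_ballP[e /= e0 eB]].
  have [a [Aa]] := cA _ (nbhsx_ballx x e e0).
  by rewrite -ball_normE /=; exists a.
have [a Aa xa] := H e e0; exists a; split => //; apply: eB.
by rewrite -ball_normE.
Qed.

Definition conv_hull B : set X := smallest (@convex_set R X) B.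

(** The definition of [convex_set], with scalars that are plain reals. *)
Definition is_convex A := forall x y (t : R), 0 <= t -> t <= 1 ->
  A x -> A y -> A (t *: x + (1 - t) *: y).

Lemma convex_setP A : @convex_set R X A <-> is_convex A.
Proof.
split=> [H x y t t0 t1 Ax Ay|H x y t].
  by have /(_ x y (Itv01 t0 t1)) := H; rewrite !inE; exact.
by rewrite !inE => Ax Ay; apply: H.
Qed.

Lemma conv_hull_convex B : is_convex (conv_hull B).
Proof.
move=> x y t t0 t1 Bx By C CP; have [/convex_setP cC _] := CP.
by apply: cC => //; [exact: Bx C CP|exact: By C CP].
Qed.

Lemma sub_conv_hull B : B `<=` conv_hull B.
Proof. by move=> x Bx C [_ BC]; exact: BC. Qed.

Lemma conv_hull_min B C : is_convex C -> B `<=` C -> conv_hull B `<=` C.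
Proof. by move=> /convex_setP cC BC x Bx; exact: Bx C (conj cC BC). Qed.

Lemma closed_convP B x : closed_conv B x <->
  forall e : R, 0 < e -> exists2 a, conv_hull B a & `|x - a| < e.
Proof. exact: closure_normP. Qed.

Lemma sub_closed_conv B : B `<=` closed_conv B.
Proof. by move=> x Bx; apply: subset_closure; exact: sub_conv_hull. Qed.

Lemma closed_conv_convex B : is_convex (closed_conv B).
Proof.
move=> x y t t0 t1 /closed_convP Bx /closed_convP By; apply/closed_convP => e e0.
have [a Ba xa] := Bx _ e0; have [b Bb yb] := By _ e0.
exists (t *: a + (1 - t) *: b); first exact: conv_hull_convex.
rewrite opprD addrACA -!scalerBr (le_lt_trans (ler_normD _ _))// !normrZ.
rewrite (ger0_norm t0) ger0_norm ?subr_ge0//.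
have [t_0|t_0] := eqVneq t 0; first by rewrite t_0 mul0r add0r subr0 mul1r.
have : 0 < t by rewrite lt_neqAle eq_sym t_0.
move: xa yb; nra.
Qed.

Lemma closed_conv_min B C : is_convex C -> closure C `<=` C -> B `<=` C -> closed_conv B `<=` C.
Proof.
move=> cC clC BC x Bx; apply: clC; apply: closure_subset x Bx.
exact: conv_hull_min.
Qed.

Lemma closed_conv_closed B : closure (closed_conv B) `<=` closed_conv B.
Proof. exact: closed_closure. Qed.

Lemma closed_conv_sub B C :
  B `<=` closed_conv C -> closed_conv B `<=` closed_conv C.
Proof.
apply: closed_conv_min; last exact: closed_conv_closed.
exact: closed_conv_convex.
Qed.

Lemma unit_ball_convex : is_convex (unit_ball X).
Proof.
move=> x y t t0 t1 Bx By; rewrite /unit_ball/= (le_trans (ler_normD _ _))// !normrZ.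
rewrite (ger0_norm t0) ger0_norm ?subr_ge0//.
by move: Bx By; rewrite /unit_ball /=; nra.
Qed.

Lemma unit_ball_closed : closure (unit_ball X) `<=` unit_ball X.
Proof.
move=> x /closure_normP Bx; apply/ler_addgt0Pr => e e0.
have [a Ba xa] := Bx _ e0.
rewrite -(subrK a x) (le_trans (ler_normD _ _))// addrC lerD//.
exact: ltW.
Qed.

End convex_hulls.

Section slices.
Context (R : realType) (X : normedModType R).
Implicit Types (A B S : set X) (x y : X).

Lemma is_slice_sub A S : is_slice A S -> S `<=` A.
Proof. by move=> [_ [f [c _ ->]]] x []. Qed.

Lemma slice_halfspace A S : is_slice A S ->
  exists (f : dual X) (c : R), S = [set x | A x /\ c < f x].
Proof.
by move=> [_ [f [al _ ->]]]; exists f, (sup [set f b | b in A] - al).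
Qed.

(** On the ball any real threshold cuts out a slice, provided that the cut is
non-empty: boundedness makes the supremum in the definition of a slice a true
supremum, so the threshold lies strictly below it. *)
Lemma halfspace_slice (f : dual X) (c : R) x :
  unit_ball X x -> c < f x ->
  is_slice (unit_ball X) [set y | unit_ball X y /\ c < f y].
Proof.
move=> Bx cx; split; first by exists x.
exists f, (sup [set f b | b in unit_ball X] - c); last first.
  by rewrite /slice; apply/seteqP; split => y /= -[By]; rewrite subKr.
rewrite subr_gt0 (lt_le_trans cx)//; apply: sup_upper_bound; last by exists x.
split; first by exists (f x), x.
exists (dual_norm f) => _ [y By <-].
by rewrite (le_trans (ler_norm _))// dual_norm_ge.
Qed.

Lemma diam_leP S (e : R) : (diam S <= e%:E)%E <->
  forall x y, S x -> S y -> `|x - y| <= e.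
Proof.
split=> [dS x y Sx Sy|H].
  rewrite -lee_fin (le_trans _ dS)//; apply: ereal_sup_ubound.
  by exists (x, y).
by apply: ge_ereal_sup => _ [[x y]/= [Sx Sy] <-]; rewrite lee_fin; exact: H.
Qed.

Lemma SCD_pointsP A a : SCD_points A a <-> A a /\ exists S : nat -> set X,
  (forall n, is_slice A (S n)) /\ forall B, B `<=` A ->
    (forall n, B `&` S n !=set0) -> closed_conv B a.
Proof.
split=> -[Aa [S [sS]]].
  by move=> [_ dS]; split => //; exists S.
move=> dS; split => //; exists S; split => //; split => // n.
by split; [exact: (sS n).1|exact: is_slice_sub (sS n)].
Qed.

(** Countably many SCD points can share one sequence of slices: put all their
sequences together.  All closure properties of the set of SCD points follow
from this. *)
Lemma SCD_points_seq A (a : nat -> X) : (forall k, SCD_points A (a k)) ->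
  exists S : nat -> set X, (forall n, is_slice A (S n)) /\
    forall B, B `<=` A -> (forall n, B `&` S n !=set0) ->
      closed_conv (range a) `<=` closed_conv B.
Proof.
move=> /(_ _)/SCD_pointsP aS.
have /choice[S SP] : forall k, exists S : nat -> set X,
  (forall n, is_slice A (S n)) /\ forall B, B `<=` A ->
    (forall n, B `&` S n !=set0) -> closed_conv B (a k).
  by move=> k; have [] := aS k.
exists (fun n => if (unpickle n : option (nat * nat)) is Some (i, j)
  then S i j else S 0 0); split.
  by move=> n; case: unpickle => [[i j]|]; exact: (SP _).1.
move=> B BA BS; apply: closed_conv_sub => _ [k _ <-].
apply: (SP k).2 => // n.
by have := BS (pickle (k, n)); rewrite pickleK.
Qed.

(** Slices around a denting point with diameters tending to 0 are determining:
a set that meets all of them has the point in its closure. *)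
Lemma dent_SCD A : dent A `<=` SCD_points A.
Proof.
move=> x [Ax dx]; apply/SCD_pointsP; split => //.
have /choice[S SP] : forall n : nat, exists S,
  [/\ is_slice A S, S x & (diam S <= (n.+1%:R^-1)%:E)%E].
  by move=> n; apply: dx; rewrite invr_gt0.
exists S; split => [n|B BA BS]; first by have [] := SP n.
apply/closed_convP => e /exists_natSinv_lt[n ne].
have [b [Bb Sb]] := BS n; exists b; first exact: sub_conv_hull.
have [_ Sx /diam_leP dS] := SP n.
by rewrite (le_lt_trans _ ne)// dS.
Qed.

Lemma SCD_points_convex A : is_convex A -> is_convex (SCD_points A).
Proof.
move=> cA x y t t0 t1 Ax Ay.
have [|S [sS dS]] := @SCD_points_seq A (fun n => if n is 0 then x else y).
  by case.
apply/SCD_pointsP; split; first by apply: cA => //; [case: Ax|case: Ay].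
exists S; split=> // B BA BS; apply: (dS B BA BS).
apply: closed_conv_convex => //; apply: sub_closed_conv; first by exists 0.
by exists 1.
Qed.

Lemma SCD_points_closed A : closure A `<=` A ->
  closure (SCD_points A) `<=` SCD_points A.
Proof.
move=> clA x cx; have /closure_normP cx' := cx.
have /choice[a aP] : forall n : nat, exists a,
    SCD_points A a /\ `|x - a| < n.+1%:R^-1.
  move=> n; have [|a ? ?] := cx' n.+1%:R^-1; first by rewrite invr_gt0.
  by exists a.
have [|S [sS dS]] := @SCD_points_seq A a; first by move=> k; exact: (aP k).1.
apply/SCD_pointsP; split.
  by apply: clA; apply: closure_subset cx => y [].
exists S; split=> // B BA BS; apply: (dS B BA BS).
apply/closed_convP => e /exists_natSinv_lt[n ne].
exists (a n); first by apply: sub_conv_hull; exists n.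
by rewrite (lt_trans _ ne)//; exact: (aP n).2.
Qed.

Lemma closed_conv_dent_SCD :
  closed_conv (dent (unit_ball X)) `<=` SCD_points (unit_ball X).
Proof.
apply: closed_conv_min; last exact: dent_SCD.
  exact: SCD_points_convex (@unit_ball_convex R X).
exact: SCD_points_closed (@unit_ball_closed R X).
Qed.

Lemma SCD_set_points A : SCD_set A -> A `<=` SCD_points A.
Proof.
move=> [S [sS dS]] x Ax; apply/SCD_pointsP; split => //; exists S; split => //.
by move=> B BA BS; exact: dS.
Qed.

(** Subsets of a separable space are separable; the sequence picks a point of
[D] near each [q i], at each scale, whenever there is one. *)
Lemma dense_seq_subset (q : nat -> X) : (forall x, closure (range q) x) ->
  forall D : set X, D !=set0 ->
  exists2 a : nat -> X, (forall n, D (a n)) & D `<=` closure (range a).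
Proof.
move=> dq D [d0 Dd0].
have /choice[a aP] : forall ik : nat * nat, exists a, D a /\
    ((exists2 d, D d & `|d - q ik.1| < ik.2.+1%:R^-1) ->
     `|a - q ik.1| < ik.2.+1%:R^-1).
  move=> [i k] /=.
  have [[d Dd dq']|no] := pselect (exists2 d, D d & `|d - q i| < k.+1%:R^-1).
    by exists d.
  by exists d0.
exists (fun n => a (odflt (0%N, 0%N) (unpickle n))); first by move=> n; exact: (aP _).1.
move=> d Dd; apply/closure_normP => e e0.
have [|k ke] := @exists_natSinv_lt R (e / 2); first by rewrite divr_gt0.
have /closure_normP/(_ k.+1%:R^-1)[|_ [i _ <-] dqi] := dq d.
  by rewrite invr_gt0.
exists (a (i, k)).
  by exists (pickle (i, k)) => //; rewrite pickleK.
have := (aP (i, k)).2; rewrite /= => /(_ (ex_intro2 _ _ d Dd dqi)) aqi.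
rewrite (le_lt_trans (ler_distD (q i) _ _))// (distrC (q i)).
by move: ke dqi aqi; move: (_.+1%:R^-1) => t; lra.
Qed.

(** A sequence dense in the set of denting points has the same closed convex
hull, so the slices shared by its terms determine the whole ball. *)
Lemma SCD_set_closed_conv_dent (q : nat -> X) :
  (forall x, closure (range q) x) ->
  unit_ball X = closed_conv (dent (unit_ball X)) -> SCD_set (unit_ball X).
Proof.
move=> dq eB; have [[d0 Dd0]|D0] := pselect (dent (unit_ball X) !=set0); last first.
  have : unit_ball X 0 by rewrite /unit_ball/= normr0.
  rewrite eB => /closed_convP/(_ 1 ltr01)[a + _].
  have : dent (unit_ball X) `<=` set0 by move=> x Dx; apply: D0; exists x.
  by move=> /(@conv_hull_min R X) /[apply]; case.
have [a aD Da] := dense_seq_subset dq (ex_intro _ d0 Dd0).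
have [S [sS dS]] := @SCD_points_seq (unit_ball X) a (fun k => dent_SCD (aD k)).
exists S; split => // B BA BS; rewrite {1}eB.
apply: subset_trans (dS B BA BS); apply: closed_conv_sub => x Dx.
by apply: closure_subset (Da x Dx); exact: sub_conv_hull.
Qed.

End slices.

(** * The free space and its dual *)

Lemma dual_le (R : realType) (X : normedModType R) (F : dual X) x :
  `|F x| <= `|F| * `|x|.
Proof.
have [->|x0] := eqVneq x 0; first by rewrite linear0 !normr0 mulr0.
rewrite -ler_pdivrMr ?normr_gt0//.
have -> : `|F x| / `|x| = `|F (`|x|^-1 *: x)|.
  by rewrite linearZ/= normrZ normfV normr_id mulrC.
by apply: dual_norm_ge; rewrite normrZ normfV normr_id mulVf ?normr_eq0.
Qed.

Section free_space.
Context (R : realType) (M : metricType R) (x0 : M).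
Notation F := (Free x0).
Implicit Types (f g : Lip0 x0) (mu nu : F).

Lemma lip0_le f x y : `|f x - f y| <= `|f| * mdist x y.
Proof. exact: lip0_norm_ge. Qed.

Lemma lip0_norm1 f x y : `|f| <= 1 -> f x - f y <= mdist x y.
Proof.
move=> f1; rewrite (le_trans (ler_norm _))// (le_trans (lip0_le _ _ _))//.
by rewrite ler_piMl// mdist_ge0.
Qed.

(** Subtracting the value at the base point turns any Lipschitz function into
an element of the dual of the free space. *)
Lemma lip0_exists (h : M -> R) (L : R) : 0 <= L ->
  (forall x y, h x - h y <= L * mdist x y) ->
  exists2 g : Lip0 x0, (forall x, g x = h x - h x0) & `|g| <= L.
Proof.
move=> L0 hL.
have hL' x y : `|(h x - h x0) - (h y - h x0)| <= L * mdist x y.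
  rewrite opprB addrA subrK ler_norml hL lerNl opprB metric_sym.
  by rewrite hL.
have gP : (fun x => h x - h x0) \in lip0_pred x0.
  by apply/asboolP; split; [rewrite subrr|exists L].
by exists (MkLip0 gP) => //; exact: lip0_norm_le.
Qed.

Lemma lip0D f g x : (f + g) x = f x + g x. Proof. by []. Qed.
Lemma lip0N f x : (- f) x = - f x. Proof. by []. Qed.
Lemma lip0Z a f x : (a *: f) x = a * f x. Proof. by []. Qed.

Lemma free_evalP (a : R) mu nu f :
  free_val (a *: mu + nu) f = a * free_val mu f + free_val nu f.
Proof. by []. Qed.

Lemma free_evalD mu nu f :
  free_val (mu + nu) f = free_val mu f + free_val nu f.
Proof. by []. Qed.

Lemma free_evalN mu f : free_val (- mu) f = - free_val mu f.
Proof. by []. Qed.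

Lemma free_evalZ (a : R) mu f : free_val (a *: mu) f = a * free_val mu f.
Proof. by []. Qed.

Lemma free_eval0 f : free_val (0 : F) f = 0.
Proof. by []. Qed.

Lemma free_eval_le mu f : `|free_val mu f| <= `|mu| * `|f|.
Proof. exact: dual_le. Qed.

Lemma free_eval_le1 mu f : `|f| <= 1 -> `|free_val mu f| <= `|mu|.
Proof.
by move=> f1; rewrite (le_trans (free_eval_le _ _))// ler_piMr.
Qed.

Lemma free_norm_le mu (c : R) :
  (forall f, `|f| <= 1 -> free_val mu f <= c) -> `|mu| <= c.
Proof.
move=> H; apply: dual_norm_le => f f1; rewrite ler_norml H// andbT.
by rewrite lerNl -linearN/= H// normrN.
Qed.

Lemma free_norming mu (e : R) : 0 < e ->
  exists2 f, `|f| <= 1 & `|mu| - e < free_val mu f.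
Proof.
move=> e0; apply: contrapT => H.
suff : `|mu| <= `|mu| - e by rewrite leNgt gtrDl oppr_lt0 e0.
apply: free_norm_le => f f1; rewrite leNgt; apply/negP => ?.
by apply: H; exists f.
Qed.

Lemma free_eval_subproof f :
  (fun mu => free_val mu f) \in @dual_pred R F.
Proof.
apply/asboolP; split=> [//|mu].
apply/(@cvgrPdist_lt _ _ _ (nbhs mu)) => e e0.
have f0 : 0 < `|f| + 1 by rewrite ltr_wpDl.
apply/nbhs_ballP; exists (e / (`|f| + 1)); first exact: divr_gt0.
move=> nu; rewrite -ball_normE /= ltr_pdivlMr// => mn.
rewrite -free_evalN -free_evalD (le_lt_trans (free_eval_le _ _))//.
by rewrite (le_lt_trans _ mn)// ler_wpM2l// lerDl.
Qed.

Definition free_eval f : dual F := Dual (free_eval_subproof f).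

Lemma free_evalE mu f : free_eval f mu = free_val mu f. Proof. by []. Qed.

Lemma dirac_subproof x : delta x0 x \in free_pred x0.
Proof.
by apply/asboolP; apply: subset_closure => A [_]; apply; exists x.
Qed.

Definition dirac x : F := MkFree (dirac_subproof x).

Lemma dirac_eval x f : free_val (dirac x) f = f x. Proof. by []. Qed.

Lemma lin_span_sub (V : lmodType R) (S : set V) : S `<=` lin_span S.
Proof. by move=> s Ss A [_ SA]; exact: SA. Qed.

Lemma lin_span_min (V : lmodType R) (S A : set V) : A 0 ->
  (forall (a : R) u v, A u -> A v -> A (a *: u + v)) -> S `<=` A ->
  lin_span S `<=` A.
Proof. by move=> A0 AP SA x Sx; exact: Sx A (conj (conj A0 AP) SA). Qed.

(** The density that defines the free space inside the dual of the Lipschitz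
functions, read inside the free space itself. *)
Lemma free_span_dense mu : closure (lin_span (range dirac)) mu.
Proof.
pose A : set (dual (Lip0 x0)) := [set phi | exists2 nu : F,
  free_val nu = phi & lin_span (range dirac) nu].
have SA : lin_span (range (@delta R M x0)) `<=` A.
  apply: lin_span_min.
  - by exists 0 => //; exact: lin_span0.
  - move=> a _ _ [u <- Su] [v <- Sv].
    by exists (a *: u + v) => //; exact: lin_spanP.
  - move=> _ [x _ <-]; exists (dirac x) => //; apply: lin_span_sub.
    by exists x.
have /asboolP/closure_normP cmu := free_valP mu.
apply/closure_normP => e /cmu[phi /SA[nu <- Snu] munu].
by exists nu.
Qed.

Lemma dirac_dist x y : `|dirac x - dirac y| <= mdist x y.
Proof.
apply: free_norm_le => f f1.
by rewrite free_evalD free_evalN !dirac_eval; exact: lip0_norm1.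
Qed.

(** The dual of the free space is the space of Lipschitz functions: the
function of [phi] is its restriction to the points of [M], and the two sides
agree on the dense span of these points. *)
Lemma dual_free_eval (phi : dual F) : exists f, forall mu, phi mu = free_val mu f.
Proof.
have hL x y : phi (dirac x) - phi (dirac y) <= `|phi| * mdist x y.
  rewrite -linearN -linearD (le_trans (ler_norm _))//.
  by rewrite (le_trans (dual_le _ _))// ler_wpM2l// dirac_dist.
have [f fE _] := lip0_exists (normr_ge0 phi) hL.
have dirac0 : dirac x0 = 0.
  apply: val_inj; apply: val_inj; apply: funext => g /=.
  exact: lip0_base.
exists f => mu; apply/eqP; rewrite -subr_eq0 -normr_le0.
apply/ler_addgt0Pr => e e0; rewrite add0r.
have k0 : 0 < `|phi| + `|f| + 1 by rewrite ltr_wpDl// addr_ge0.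
have /closure_normP/(_ (e / (`|phi| + `|f| + 1)))[|nu Snu] :=
  @free_span_dense mu.
  exact: divr_gt0.
rewrite ltr_pdivlMr// => munu.
have E : phi nu = free_val nu f.
  move: nu Snu {munu}; apply: lin_span_min.
  - by rewrite linear0.
  - by move=> a u v uE vE; rewrite linearP/= uE vE.
  - by move=> _ [x _ <-]; rewrite dirac_eval fE dirac0 linear0 subr0.
have -> : phi mu - free_val mu f = phi (mu - nu) - free_val (mu - nu) f.
  have -> : phi (mu - nu) = phi mu - phi nu by exact: linearB.
  by rewrite free_evalD free_evalN E; ring.
rewrite (le_trans (ler_normB _ _))// (le_trans _ (ltW munu))//.
rewrite (le_trans (lerD (dual_le _ _) (free_eval_le _ _)))//.
by have := normr_ge0 (mu - nu); lra.
Qed.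

Definition molecule x y : F := (mdist x y)^-1 *: (dirac x - dirac y).

Lemma molecule_eval x y f :
  free_val (molecule x y) f = (f x - f y) / mdist x y.
Proof. by rewrite free_evalZ free_evalD free_evalN !dirac_eval mulrC. Qed.

Lemma molecule_ball x y : unit_ball F (molecule x y).
Proof.
rewrite /unit_ball/= normrZ; have [->|xy] := eqVneq x y.
  by rewrite subrr normr0 mulr0.
have d0 : 0 < mdist x y by rewrite mdist_gt0.
by rewrite gtr0_norm ?invr_gt0// ler_pdivrMl// mulr1 dirac_dist.
Qed.

(** Since the distance is symmetric, a one-sided bound suffices. *)
Lemma lip0_bound f (c : R) : 0 <= c ->
  (forall x y, f x - f y <= c * mdist x y) -> `|f| <= c.
Proof.
move=> c0 fc; apply: lip0_norm_le => // x y.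
by rewrite ler_norml fc lerNl opprB metric_sym fc.
Qed.

(** Evaluation at a finitely supported element only feels the uniform
distance between functions. *)
Lemma lin_span_dirac_bound nu : lin_span (range dirac) nu ->
  exists2 K : R, 0 <= K & forall f (c : R), (forall x, `|f x| <= c) ->
    `|free_val nu f| <= K * c.
Proof.
move: nu; apply: lin_span_min.
- by exists 0 => // f c _; rewrite free_eval0 normr0 mul0r.
- move=> a u v [K K0 HK] [L L0 HL]; exists (`|a| * K + L).
    by rewrite addr_ge0// mulr_ge0.
  move=> f c fc; rewrite free_evalP (le_trans (ler_normD _ _))// normrM.
  by rewrite mulrDl lerD ?HL// -mulrA ler_wpM2l// HK.
- move=> _ [x _ <-]; exists 1 => // f c fc.
  by rewrite dirac_eval mul1r.
Qed.

End free_space.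

Section separability.
Context (R : realType) (M : metricType R) (x0 : M).
Notation F := (Free x0).

(** Rational combinations of point evaluations at a countable dense subset are
dense. *)
Lemma separable_free : separable_space M ->
  exists q : nat -> F, forall mu, closure (range q) mu.
Proof.
move=> [D [cD dD]].
have dD' (x : M) (e : R) : 0 < e -> exists2 y, D y & mdist x y < e.
  move=> e0; have [||y [+ Dy]] := dD (ball x e)°.
  - by exists x; exact: nbhsx_ballx.
  - exact: open_interior.
  - by move=> /interior_subset; rewrite ballEmdist; exists y.
have [p pD] : exists p : nat -> M, D `<=` range p.
  have /countable_injP[f f_inj] := cD.
  have [y Dy _] := dD' x0 1 ltr01.
  have /choice[p pP] : forall n : nat, exists x,
      forall y, D y -> f y = n -> x = y.
    move=> n; have [[x Dx fx]|no] := pselect (exists2 x, D x & f x = n).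
      by exists x => z Dz fz; apply: f_inj; rewrite ?inE// fx fz.
    by exists y => z Dz fz; exfalso; apply: no; exists z.
  exists p => x Dx; exists (f x) => //; exact: pP.
pose ev (s : seq (rat * nat)) : F := \sum_(t <- s) ratr t.1 *: dirac x0 (p t.2).
have evM (a : rat) s : ratr a *: ev s = ev [seq (a * t.1, t.2) | t <- s].
  rewrite /ev scaler_sumr big_map; apply: eq_bigr => t _.
  by rewrite scalerA rmorphM.
have evD s t : ev s + ev t = ev (s ++ t) by rewrite /ev big_cat.
exists (fun n => ev (odflt [::] (unpickle n))) => mu.
set A := (X in closure X _).
have evA s : A (ev s) by exists (pickle s); rewrite // pickleK.
suff : lin_span (range (@dirac _ _ x0)) `<=` closure A.
  move=> /closure_subset/(_ _ (@free_span_dense _ _ x0 mu)).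
  exact: closed_closure.
apply: lin_span_min.
- by apply: subset_closure; have := evA [::]; rewrite /ev big_nil.
- move=> a u v /closure_normP cu /closure_normP cv; apply/closure_normP => e e0.
  have e3 : 0 < e / 3 by rewrite divr_gt0.
  have k0 : 0 < `|u| + 1 by rewrite ltr_wpDl.
  have [r [evr rP]] : exists r : R,
      (forall s, exists s', r *: ev s = ev s') /\
      `|a - r| * (`|u| + 1) < e / 3.
    have [|r] := @rat_in_itvoo R (a - e / 3 / (`|u| + 1)) a.
      by rewrite gtrDl oppr_lt0 divr_gt0.
    rewrite in_itv/= => /andP[r1 r2]; exists (ratr r); split.
      by move=> s; eexists; exact: evM.
    by rewrite -ltr_pdivlMr// gtr0_norm ?subr_gt0// ltrBlDl -ltrBlDr.
  have k1 : 0 < `|r| + 1 by rewrite ltr_wpDl.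
  have [_ [n _ <-] un] := cu _ (divr_gt0 e3 k1).
  have [_ [m _ <-] vm] := cv _ e3.
  move: un vm; set s := odflt _ _; set t := odflt _ _ => un vm.
  exists (r *: ev s + ev t).
    by have [s' ->] := evr s; rewrite evD.
  have -> : a *: u + v - (r *: ev s + ev t) =
      (a - r) *: u + r *: (u - ev s) + (v - ev t).
    by rewrite scalerBl scalerBr !addrA subrK opprD !addrA (addrAC _ v).
  rewrite (le_lt_trans (ler_normD _ _))//.
  rewrite (le_lt_trans (lerD (ler_normD _ _) (lexx _)))// !normrZ.
  rewrite ltr_pdivlMr// in un.
  have := normr_ge0 (a - r); have := normr_ge0 (u - ev s).
  by move: rP un vm; lra.
- move=> _ [x _ <-]; apply/closure_normP => e e0.
  have [y Dy xy] := dD' x e e0; have [n _ pn] := pD y Dy.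
  exists (ev [:: (1, n)]) => //.
  rewrite /ev big_seq1 rmorph1 scale1r /= pn.
  by rewrite (le_lt_trans (dirac_dist _ _ _)).
Qed.

End separability.

(** * Steep pairs with nothing in between *)

Section variational.
Context (R : realType).

Definition seq_cauchy (T : Type) (rho : T -> T -> R) (u : nat -> T) :=
  forall e : R, 0 < e -> exists N, forall m n, (N <= m)%N -> (N <= n)%N ->
    rho (u m) (u n) < e.

Definition seq_complete (T : Type) (rho : T -> T -> R) :=
  forall u : nat -> T, seq_cauchy rho u -> exists l, forall e : R, 0 < e ->
    exists N, forall n, (N <= n)%N -> rho (u n) l < e.

Lemma complete_space_seq (M : metricType R) :
  complete_space M -> seq_complete (@mdist R M).
Proof.
move=> cM u cu.
have [|l ul] := cM (u n @[n --> \oo]) _.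
  apply/cauchy_ballP => e e0; have [N uN] := cu e e0.
  exists ([set u n | n in [set n | (N <= n)%N]],
          [set u n | n in [set n | (N <= n)%N]]) => /=.
    by split; exists N => // n /= Nn; exists n.
  by move=> [_ _] /= [[m Nm <-] [n Nn <-]]; rewrite ballEmdist; exact: uN.
exists l => e e0.
have /(_ (ball l e) (nbhsx_ballx l e e0))[N _ NP] := ul.
exists N => n Nn; have := NP n Nn.
by rewrite /= ballEmdist /= metric_sym.
Qed.

(** Ekeland's variational principle, obtained from Zorn's lemma.  The
relation Q x y (the move from x to y is paid for by the decrease of J) is a
preorder; along a chain, J bounds the distances, so minimizing sequences of the
chain are Cauchy and their limit dominates the chain. *)
Lemma ekeland (T : Type) (rho : T -> T -> R) (J : T -> R) (C m : R) (t0 : T) :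
  (forall x, rho x x = 0) -> (forall x y, 0 <= rho x y) ->
  (forall x y, rho x y = rho y x) ->
  (forall x y z, rho x z <= rho x y + rho y z) ->
  seq_complete rho -> 0 <= C ->
  (forall x y, J x - J y <= C * rho x y) -> (forall x, m <= J x) ->
  exists t, forall s, J s + rho t s <= J t -> rho t s = 0.
Proof.
move=> rxx r0 rC rD cT C0 JC Jm.
pose Q x y := `[< J y + rho x y <= J x >].
have [|||t tP] := @ZL_preorder T t0 Q.
- by move=> t; apply/asboolP; rewrite rxx addr0.
- move=> r s t /asboolP rs /asboolP st; apply/asboolP.
  by have := rD r s t; lra.
- move=> A tA; have [[a0 Aa0]|A0] := pselect (A !=set0); last first.
    by exists t0 => s As; exfalso; apply: A0; exists s.
  have iA : has_inf (J @` A).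
    by split; [exists (J a0), a0|exists m => _ [x _ <-]].
  have /choice[y yP] : forall n : nat, exists y,
      A y /\ J y < inf (J @` A) + n.+1%:R^-1.
    move=> n; have [|_ [y Ay <-] Jy] := @inf_adherent _ _ n.+1%:R^-1 _ iA.
      by rewrite invr_gt0.
    by exists y.
  have Jinf x : A x -> inf (J @` A) <= J x.
    by move=> Ax; apply: ge_inf; [exact: iA.2|exists x].
  (* a minimizing sequence is almost below every member of the chain, whichever
     way the two are ordered *)
  have key s n : A s -> J (y n) + rho s (y n) <= J s + 2 * n.+1%:R^-1.
    move=> As; have [Ay] := yP n; have := Jinf s As.
    have : 0 < n.+1%:R^-1 :> R by rewrite invr_gt0.
    move: (_.+1%:R^-1) => k k0.
    by have [/asboolP|/asboolP] := tA _ _ As Ay; rewrite ?(rC s); lra.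
  have [|l lP] := cT y.
    move=> e e0; have [|N Ne] := @exists_natSinv_lt R (e / 3).
      by rewrite divr_gt0.
    exists N => i j Ni Nj.
    have := key (y i) j (yP i).1; have := (yP i).2; have := Jinf _ (yP j).1.
    have H k : (N <= k)%N -> k.+1%:R^-1 <= N.+1%:R^-1 :> R.
      by move=> Nk; rewrite lef_pV2 ?posrE// ler_nat.
    move: (H i Ni) (H j Nj) Ne.
    by move: (N.+1%:R^-1) (i.+1%:R^-1) (j.+1%:R^-1) => *; lra.
  exists l => s As; apply/asboolP/ler_addgt0Pr => e e0.
  have [|N Ne] := @exists_natSinv_lt R (e / 4); first by rewrite divr_gt0.
  have [|N' N'P] := lP (e / 2 / (1 + C)).
    by rewrite !divr_gt0// ltr_pwDl.
  have := N'P (maxn N N') (leq_maxr _ _); set n := maxn N N'.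
  rewrite ltr_pdivlMr; last by rewrite ltr_pwDl.
  have : n.+1%:R^-1 <= N.+1%:R^-1 :> R.
    by rewrite lef_pV2 ?posrE// ler_nat ltnS leq_maxl.
  have := key s n As; have := JC l (y n); rewrite (rC l).
  have := rD s (y n) l; move: Ne.
  by move: (N.+1%:R^-1) (n.+1%:R^-1) => *; lra.
exists t => s st; have /asboolP := tP s (asboolT st).
by rewrite (rC s); have := r0 t s; lra.
Qed.

(** On pairs that stay s apart, the slope of f is a Lipschitz function of the
pair; this makes it an admissible ingredient in Ekeland's principle. *)
Lemma slope_lipschitz (M : metricType R) (f : M -> R) (L s : R) (p q : M * M) :
  0 <= L -> 0 < s -> (forall x y, f x - f y <= L * mdist x y) ->
  s <= mdist p.1 p.2 -> s <= mdist q.1 q.2 ->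
  (f q.1 - f q.2) / mdist q.1 q.2 - (f p.1 - f p.2) / mdist p.1 p.2 <=
  2 * L / s * (mdist p.1 q.1 + mdist p.2 q.2).
Proof.
case: p q => [x y] [u v] /= L0 s0 fL sp sq.
have p0 := lt_le_trans s0 sp; have q0 := lt_le_trans s0 sq.
set D := mdist x u + _; set b := _ / mdist u v; set a := _ / mdist x y.
have D0 : 0 <= D by rewrite addr_ge0// mdist_ge0.
have aE : a * mdist x y = f x - f y by rewrite mulfVK// gt_eqF.
have bE : b * mdist u v = f u - f v by rewrite mulfVK// gt_eqF.
have bL : `|b| <= L.
  rewrite ler_norml /b ler_pdivrMr// ler_pdivlMr// fL mulNr lerNl opprB.
  by rewrite metric_sym fL.
have dD : `|mdist x y - mdist u v| <= D.
  rewrite ler_norml /D; have := metric_triangle x u y.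
  have := metric_triangle u v y; have := metric_triangle u x v.
  have := metric_triangle x y v; rewrite (metric_sym u x) (metric_sym v y).
  lra.
have fD : b * mdist u v - a * mdist x y <= L * D.
  rewrite aE bE /D; have := fL u x; have := fL y v.
  by rewrite (metric_sym u x); lra.
have bD : b * (mdist x y - mdist u v) <= L * D.
  by rewrite (le_trans (ler_norm _))// normrM ler_pM.
have H : (b - a) * mdist x y <= 2 * L * D by lra.
have [ba|ba] := leP (b - a) 0.
  by rewrite (le_trans ba)// mulr_ge0// divr_ge0 ?mulr_ge0// ltW.
rewrite mulrAC ler_pdivlMr// (le_trans _ H)// ler_wpM2l// ltW//.
Qed.

(** Subdividing a pair at a point z that is almost on a segment does not lower the
slope of both halves, since the slope of the pair is almost a mean of the two;
one half then is shorter and about as steep.  Hence at a pair where no change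
of an endpoint pays, such z must be close to x or to y.  Ekeland's principle
provides such a pair for J p = d p - K * sl p, distance penalized by slope: K
is so large that J p <= J (a, b) forces the slope to remain above c. *)
Lemma isolated_steep_pair (M : metricType R) (f : M -> R) (L c s : R) (a b : M) :
  complete_space M -> 0 <= L -> 0 < s ->
  (forall x y, f x - f y <= L * mdist x y) ->
  (forall x y, x != y -> c * mdist x y < f x - f y -> s <= mdist x y) ->
  a != b -> c * mdist a b < f a - f b ->
  exists x y, [/\ x != y, c * mdist x y < f x - f y &
    forall e : R, 0 < e -> exists2 del : R, 0 < del &
      forall z, mdist x z + mdist z y < mdist x y + del ->
        mdist x z < e \/ mdist z y < e].
Proof.
move=> cM L0 s0 fL small ab cab.
pose d (p : M * M) := mdist p.1 p.2.
pose sl (p : M * M) := (f p.1 - f p.2) / d p.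
have d_gt0 p : s <= d p -> 0 < d p by exact: lt_le_trans.
have slE p : 0 < d p -> sl p * d p = f p.1 - f p.2.
  by move=> p0; rewrite mulfVK// gt_eqF.
have dab : 0 < d (a, b) by rewrite mdist_gt0.
have slab : c < sl (a, b) by rewrite ltr_pdivlMr.
pose K := (d (a, b) + 1) / (sl (a, b) - c).
have K0 : 0 < K by rewrite divr_gt0 ?subr_gt0// ltr_wpDl// ltW.
have KE : K * (sl (a, b) - c) = d (a, b) + 1.
  by rewrite mulfVK// subr_eq0 gt_eqF.
pose J p := d p - K * sl p.
pose E (p : M * M) := s <= d p /\ J p <= J (a, b).
have Eab : E (a, b) by split => //; exact: small.
pose D (p q : M * M) := mdist p.1 q.1 + mdist p.2 q.2.
have D0 p q : 0 <= D p q by rewrite addr_ge0// mdist_ge0.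
pose C := 2 * (1 + K * (2 * L / s)).
have C0 : 0 <= C.
  apply: mulr_ge0 => //; apply: addr_ge0 => //; apply: mulr_ge0; first exact: ltW.
  by apply: divr_ge0; [exact: mulr_ge0|exact: ltW].
have dD p q : d p - d q <= D p q.
  rewrite /d /D; have := metric_triangle p.1 q.1 p.2.
  have := metric_triangle q.1 q.2 p.2; rewrite (metric_sym q.2).
  lra.
have JC p q : s <= d p -> s <= d q -> J p - J q <= C * (D p q / 2).
  move=> sp sq; have := slope_lipschitz L0 s0 fL sp sq.
  rewrite -/(d _) -/(d _) -/(sl _) -/(sl _) -/(D p q) => H.
  have := ler_wpM2l (ltW K0) H; have := dD p q.
  by rewrite /J /C; move: (2 * L / s) => k; lra.
have slL p : s <= d p -> sl p <= L.
  by move=> sp; rewrite ler_pdivrMr ?d_gt0//; exact: fL.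
pose T := {p : M * M | E p}.
have sT (t : T) : s <= d (sval t) by case: t => ? [].
have [||||||||[[x y] Exy] /= xyP] :=
  @ekeland T (fun t t' => D (sval t) (sval t') / 2) (fun t => J (sval t))
    C (- (K * L)) (exist _ (a, b) Eab).
- by move=> t; rewrite /D !mdistxx addr0 mul0r.
- by move=> t t'; rewrite divr_ge0.
- by move=> t t'; rewrite /D (metric_sym (sval t).1) (metric_sym (sval t).2).
- move=> t t' t''; rewrite -mulrDl ler_pM2r// /D.
  have := metric_triangle (sval t).1 (sval t').1 (sval t'').1.
  have := metric_triangle (sval t).2 (sval t').2 (sval t'').2.
  lra.
- move=> u cu.
  have [|l1 l1P] := @complete_space_seq M cM (fun n => (sval (u n)).1).
    move=> e e0; have [|N NP] := cu (e / 2); first by rewrite divr_gt0.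
    exists N => i j Ni Nj; have := NP i j Ni Nj; rewrite /D.
    by have := mdist_ge0 (sval (u i)).2 (sval (u j)).2; lra.
  have [|l2 l2P] := @complete_space_seq M cM (fun n => (sval (u n)).2).
    move=> e e0; have [|N NP] := cu (e / 2); first by rewrite divr_gt0.
    exists N => i j Ni Nj; have := NP i j Ni Nj; rewrite /D.
    by have := mdist_ge0 (sval (u i)).1 (sval (u j)).1; lra.
  have lP e : 0 < e -> exists N, forall n, (N <= n)%N ->
      D (sval (u n)) (l1, l2) < e.
    move=> e0; have e2 : 0 < e / 2 by rewrite divr_gt0.
    have [N1 N1P] := l1P _ e2; have [N2 N2P] := l2P _ e2.
    exists (maxn N1 N2) => n; rewrite geq_max => /andP[n1 n2].
    by have := N1P n n1; have := N2P n n2; rewrite /D/=; lra.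
  have sl12 : s <= d (l1, l2).
    apply/ler_addgt0Pr => e /lP[N /(_ N (leqnn N)) H].
    by have := sT (u N); have := dD (sval (u N)) (l1, l2); lra.
  have El : E (l1, l2).
    split => //; apply/ler_addgt0Pr => e e0.
    have [|N /(_ N (leqnn N)) H] := lP (e / (C + 1)).
      by rewrite divr_gt0// ltr_wpDl.
    have := JC (l1, l2) (sval (u N)) sl12 (sT _).
    have -> : D (l1, l2) (sval (u N)) = D (sval (u N)) (l1, l2).
      by rewrite /D/= (metric_sym l1) (metric_sym l2).
    move: H; rewrite ltr_pdivlMr; last by rewrite ltr_wpDl.
    have JN : J (sval (u N)) <= J (a, b) by case: (u N) => ? [].
    have := D0 (sval (u N)) (l1, l2); move: JN.
    have := mulr_ge0 C0 (D0 (sval (u N)) (l1, l2)).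
    by lra.
  exists (exist _ (l1, l2) El) => e e0 /=.
  have [|N NP] := lP e => //; exists N => n Nn.
  by have := NP n Nn; have := D0 (sval (u n)) (l1, l2); lra.
- exact: C0.
- by move=> t t'; exact: JC.
- move=> t; have := ler_wpM2l (ltW K0) (slL _ (sT t)).
  by have := d_gt0 _ (sT t); rewrite /J; lra.
have [sxy Jxy] := Exy.
have xy0 := d_gt0 _ sxy.
have slxy : c < sl (x, y).
  by rewrite -(ltr_pM2l K0); move: Jxy KE; rewrite /J; lra.
exists x, y; split; first by rewrite -mdist_gt0.
  by have := ltr_pM2r xy0 c (sl (x, y)); rewrite slE// slxy.
move=> e e0.
have k0 : 0 <= L / s by rewrite divr_ge0// ltW.
pose k := L / s.
(* the slope of one of the two halves is at least the old one minus del * k *)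
pose del := Num.min (e / 2 / (1 + K * k)) ((sl (x, y) - c) / (k + 1)).
have k1 : 0 < 1 + K * k by rewrite ltr_pwDl// mulr_ge0// ltW.
have k2 : 0 < k + 1 by rewrite ltr_wpDl.
have del0 : 0 < del by rewrite lt_min !divr_gt0 ?subr_gt0.
have del1 : del * (1 + K * k) <= e / 2 by rewrite -ler_pdivlMr// ge_min lexx.
have del2 : del * (k + 1) <= sl (x, y) - c.
  by rewrite -ler_pdivlMr// ge_min lexx orbT.
exists del => // z xyz; apply: contrapT => /not_orP[/negP + /negP].
rewrite -!leNgt => xz zy.
have xz0 : 0 < mdist x z by exact: lt_le_trans xz.
have zy0 : 0 < mdist z y by exact: lt_le_trans zy.
have slD : sl (x, z) * mdist x z + sl (z, y) * mdist z y =
    sl (x, y) * mdist x y.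
  by rewrite -!/(d (_, _)) !slE//= addrA subrK.
pose t := sl (x, y) - del * k.
have tc : c < t by rewrite /t; move: del2; lra.
have tS : t * (mdist x z + mdist z y) <= sl (x, y) * mdist x y.
  have tri : mdist x y <= mdist x z + mdist z y by exact: metric_triangle.
  rewrite /t; have H1 : sl (x, y) * (mdist x z + mdist z y - mdist x y) <=
      L * del.
    rewrite (@le_trans _ _ (L * (mdist x z + mdist z y - mdist x y)))//.
      by rewrite ler_wpM2r ?subr_ge0// slL.
    by rewrite ler_wpM2l// lerBlDl ltW.
  have H2 : L * del <= del * k * (mdist x z + mdist z y).
    rewrite mulrC /k -!mulrA ler_wpM2l ?(ltW del0)// ler_peMr//.
    by rewrite mulrC ler_pdivlMr// mul1r (le_trans sxy).
  by move: H1 H2; lra.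
(* one of the halves x, z and z, y has slope at least t; that half would be a
   better pair *)
have [zt|zt] := leP t (sl (x, z)).
  have sxz : s <= d (x, z).
    apply: small; first by rewrite -mdist_gt0.
    by rewrite -ltr_pdivlMr// (lt_le_trans tc).
  have Jz : J (x, z) + D (x, y) (x, z) / 2 <= J (x, y).
    rewrite /J /D /= mdistxx add0r (metric_sym y z).
    have := ler_wpM2l (ltW K0) zt; rewrite /t.
    by move: del1 xyz zy; rewrite /d/=; lra.
  have Exz : E (x, z).
    by split => //; have := D0 (x, y) (x, z); move: Jz Jxy; lra.
  have := xyP (exist _ (x, z) Exz) Jz.
  by rewrite /D/= mdistxx add0r (metric_sym y z); lra.
have zt' : t <= sl (z, y).
  rewrite leNgt; apply/negP => zt'.
  have : t * (mdist x z + mdist z y) < t * (mdist x z + mdist z y).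
    rewrite {2}mulrDr; apply: (le_lt_trans tS).
    by rewrite -slD ltrD// ltr_pM2r.
  by rewrite ltxx.
have szy : s <= d (z, y).
  apply: small; first by rewrite -mdist_gt0.
  by rewrite -ltr_pdivlMr// (lt_le_trans tc).
have Jz : J (z, y) + D (x, y) (z, y) / 2 <= J (x, y).
  rewrite /J /D /= mdistxx addr0.
  have := ler_wpM2l (ltW K0) zt'; rewrite /t.
  by move: del1 xyz xz; rewrite /d/=; lra.
have Ezy : E (z, y).
  by split => //; have := D0 (x, y) (z, y); move: Jz Jxy; lra.
have := xyP (exist _ (z, y) Ezy) Jz.
by rewrite /D/= mdistxx addr0; lra.
Qed.

End variational.

(** * Denting molecules *)

(** The estimate behind the peak function below: there a, b are the distances
of u to x and y, a', b' those of v, and D is the distance of u and v. *)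
Lemma peak_slope (R : realType) (a b a' b' D : R) :
  0 <= a -> 0 <= b -> 0 <= a' -> 0 <= b' -> 0 < a + b -> 0 < a' + b' ->
  a' - a <= D -> b - b' <= D ->
  (b - a) / (a + b) - (b' - a') / (a' + b') <= 2 * D / (a + b) /\
  (b - a) / (a + b) - (b' - a') / (a' + b') <= 2 * D / (a' + b').
Proof.
move=> a0 b0 a'0 b'0 s0 s'0 aD bD.
have -> : (b - a) / (a + b) - (b' - a') / (a' + b') =
    2 * (b * a' - a * b') / ((a + b) * (a' + b')).
  by field; rewrite !gt_eqF.
have H1 : b * a' - a * b' <= D * (a' + b').
  have := ler_wpM2r a'0 bD; have := ler_wpM2r b'0 aD; lra.
have H2 : b * a' - a * b' <= D * (a + b).
  have := ler_wpM2r a0 bD; have := ler_wpM2r b0 aD; lra.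
split; rewrite ler_pdivrMr ?mulr_gt0//.
  have -> : 2 * D / (a + b) * ((a + b) * (a' + b')) = 2 * (D * (a' + b')).
    by field; rewrite gt_eqF.
  by rewrite ler_pM2l.
have -> : 2 * D / (a' + b') * ((a + b) * (a' + b')) = 2 * (D * (a + b)).
  by field; rewrite gt_eqF.
by rewrite ler_pM2l.
Qed.

Section denting.
Context (R : realType) (M : metricType R).

(** The function g is a weighted mean of two 1-Lipschitz functions.

The first one, f, is linear in the ratio of the distances to x and y.  It has
slope 1 at x, y, but slope at most 1 - 2 * t as soon as one of the two points is
not almost between x and y.  The second one, h, is the distance to y, made
constant near x and near y, so it kills the slope of pairs contained in one of
the two small balls.  As h has the small weight t, its loss at x, y is 2 * t * r,
which is small compared with the gap t if r is small. *)
Lemma peak_function (x y : M) (r del : R) : 0 < r -> 4 * r <= mdist x y ->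
  0 < del ->
  (forall z, mdist x z + mdist z y < mdist x y + del ->
    mdist x z < r \/ mdist z y < r) ->
  exists (g : M -> R) (t : R), [/\ 0 < t, t <= 1,
    forall u v, g u - g v <= mdist u v,
    g x - g y = mdist x y - 2 * t * r &
    forall u v, g u - g v <= (1 - t) * mdist u v \/
      (mdist u x < r /\ mdist v y < r)].
Proof.
move=> r0 rd del0 near; set d := mdist x y in rd near *.
have d0 : 0 < d by move: rd; lra.
pose S (z : M) := mdist z x + mdist z y.
have Sd z : d <= S z.
  by rewrite /S /d (metric_sym z x); exact: metric_triangle.
have S0 z : 0 < S z by exact: lt_le_trans (Sd z).
pose f (z : M) := d / 2 * ((mdist z y - mdist z x) / S z).
pose h (z : M) := Num.max r (Num.min (mdist z y) (d - r)).
pose t := del / (d + del) / 2.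
have dd0 : 0 < d + del by rewrite addr_gt0.
have t0 : 0 < t by rewrite !divr_gt0.
have tE : (1 - 2 * t) * (d + del) = d by rewrite /t; field; rewrite gt_eqF.
have t1 : 2 * t <= 1.
  by rewrite /t mulrC mulfVK// ler_pdivrMr// mul1r lerDr ltW.
have fS u v : f u - f v <= mdist u v * (d / S u) /\
    f u - f v <= mdist u v * (d / S v).
  have [||H1 H2] := @peak_slope R (mdist u x) (mdist u y) (mdist v x)
      (mdist v y) (mdist u v) (mdist_ge0 _ _) (mdist_ge0 _ _)
      (mdist_ge0 _ _) (mdist_ge0 _ _) (S0 u) (S0 v).
    by have := metric_triangle v u x; rewrite (metric_sym v u); lra.
    by have := metric_triangle u v y; lra.
  have d2 : 0 <= d / 2 by rewrite divr_ge0// ltW.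
  rewrite /f -mulrBr; split.
    apply: (le_trans (ler_wpM2l d2 H1)); rewrite le_eqVlt; apply/orP; left.
    by apply/eqP; rewrite -/(S u); field; rewrite gt_eqF.
  apply: (le_trans (ler_wpM2l d2 H2)); rewrite le_eqVlt; apply/orP; left.
  by apply/eqP; rewrite -/(S v); field; rewrite gt_eqF.
have f1 u v : f u - f v <= mdist u v.
  rewrite (le_trans (fS u v).1)// ler_piMr ?mdist_ge0//.
  by rewrite ler_pdivrMr// mul1r.
have hlip u v : h u - h v <= mdist u v.
  have := metric_triangle u v y; have := mdist_ge0 u v; rewrite /h.
  rewrite /Num.max /Num.min.
  by do !case: ifP => /negP; rewrite -?leNgt; lra.
have far u v z : z = u \/ z = v -> d + del <= S z ->
    f u - f v <= (1 - 2 * t) * mdist u v.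
  move=> zE Sz.
  have H : d / S z <= 1 - 2 * t.
    rewrite ler_pdivrMr// -{1}tE ler_wpM2l//; lra.
  have : mdist u v * (d / S z) <= (1 - 2 * t) * mdist u v.
    by rewrite mulrC ler_wpM2r ?mdist_ge0.
  by apply: le_trans; case: zE => ->; have [] := fS u v.
have hx z : mdist z x < r -> h z = d - r.
  move=> zx; have := metric_triangle x z y; rewrite -/d (metric_sym x) /h => ?.
  by rewrite min_r ?max_r//; lra.
have hy z : mdist z y < r -> h z = r.
  by move=> zy; rewrite /h min_l ?max_l//; lra.
have nearP z : [\/ d + del <= S z, mdist z x < r | mdist z y < r].
  have [H|H] := leP (d + del) (S z); first by constructor 1.
  rewrite /S (metric_sym z x) in H *.
  by have [] := near z H => ?; [constructor 2|constructor 3].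
exists (fun z => (1 - t) * f z + t * h z), t; split => //.
- by lra.
- move=> u v; have := f1 u v; have := hlip u v => H1 H2.
  have t1' : 0 <= 1 - t by lra.
  by have := ler_wpM2l t1' H2; have := ler_wpM2l (ltW t0) H1; lra.
- have fx : f x = d / 2.
    by rewrite /f /S mdistxx subr0 add0r divff ?mulr1// gt_eqF.
  have fy : f y = - (d / 2).
    rewrite /f /S mdistxx (metric_sym y x) -/d sub0r addr0 mulNr divff ?gt_eqF//.
    by rewrite mulrN1.
  by rewrite fx fy hx ?mdistxx// hy ?mdistxx//; lra.
move=> u v; have := nearP u; have := nearP v.
have D0 := mdist_ge0 u v.
have t1' : 0 <= 1 - t by lra.
have hF := ler_wpM2l (ltW t0) (hlip u v).
have fF := ler_wpM2l t1' (f1 u v).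
have away z : z = u \/ z = v -> d + del <= S z ->
    (1 - t) * f u + t * h u - ((1 - t) * f v + t * h v) <=
    (1 - t) * mdist u v.
  move=> zE Sz; have := ler_wpM2l t1' (far u v z zE Sz).
  have t2 : 0 <= 1 - 2 * t by lra.
  have := mulr_ge0 (mulr_ge0 (ltW t0) t2) D0.
  by move: hF; lra.
case=> [/(away v (or_intror erefl))|vx|vy]; first by left.
  case=> [/(away u (or_introl erefl))|ux|uy]; first by left.
    by left; rewrite (hx u)// (hx v)//; move: fF; lra.
  left; rewrite (hy u)// (hx v)//.
  have dr : 0 <= d - 2 * r by lra.
  have := mulr_ge0 (ltW t0) dr.
  by move: fF; lra.
case=> [/(away u (or_introl erefl))|ux|uy]; first by left.
  by right.
by left; rewrite (hy u)// (hy v)//; move: fF; lra.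
Qed.

(** Let g be a peak function.  On the slice where xi(g) > 1 - sg, every q of norm at
most 1 must satisfy xi(q) <= H + small, where H is the value of q at the
molecule.  Indeed the function g + th * (q - H * g) has norm at most 1 + th * k,
with k of the order of r: where g has slope at most 1 - t, the perturbation is
absorbed by t = 2 * th; elsewhere the pair is close to x, y, and there q - H * g
has almost no slope.  Evaluating at xi gives the bound.  This duality argument
avoids writing xi as a combination of molecules. *)
Lemma denting_molecule (x0 x y : M) : x != y ->
  (forall e : R, 0 < e -> exists2 del : R, 0 < del &
    forall z, mdist x z + mdist z y < mdist x y + del ->
      mdist x z < e \/ mdist z y < e) ->
  dent (unit_ball (Free x0)) (molecule x0 x y).
Proof.
move=> xy crit; split; first exact: molecule_ball.
move=> e e0; set d := mdist x y.
have d0 : 0 < d by rewrite /d mdist_gt0.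
(* the estimates below add up to a distance of 24 * r / d from the molecule *)
pose r := Num.min (d / 4) (e * d / 48).
have r0 : 0 < r by rewrite lt_min !divr_gt0// mulr_gt0.
have r1 : 4 * r <= d by rewrite mulrC -ler_pdivlMr// ge_min lexx.
have r2 : 48 * r <= e * d by rewrite mulrC -ler_pdivlMr// ge_min lexx orbT.
have [del del0 near] := crit r r0.
have [g' [t [t0 t1 g'lip g'xy g'near]]] := peak_function r0 r1 del0 near.
have [|g gE g1] := @lip0_exists R M x0 g' 1 ler01.
  by move=> u v; rewrite mul1r.
have gB u v : g u - g v = g' u - g' v by rewrite !gE; ring.
pose sg := 4 * t * r / d.
have sgE : sg * d = 4 * t * r by rewrite /sg mulfVK// gt_eqF.
have sg0 : 0 < sg by rewrite divr_gt0// !mulr_gt0.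
exists [set xi | unit_ball (Free x0) xi /\ 1 - sg < free_eval g xi].
have mg : 1 - sg < free_eval g (molecule x0 x y).
  rewrite free_evalE molecule_eval gB g'xy -/d ltr_pdivlMr// mulrBl sgE.
  by have := mulr_gt0 t0 r0; lra.
split; first exact: halfspace_slice (molecule_ball x0 x y) mg.
  by split; [exact: molecule_ball|exact: mg].
suff key xi : unit_ball (Free x0) xi -> 1 - sg < free_val xi g ->
    `|xi - molecule x0 x y| <= e / 2.
  apply/diam_leP => xi nu [Bxi xig] [Bnu nug].
  rewrite (le_trans (ler_distD (molecule x0 x y) _ _))//.
  by rewrite (distrC _ nu) [leRHS]splitr lerD ?key.
move=> Bxi xig; apply: free_norm_le => q q1.
rewrite free_evalD free_evalN molecule_eval -/d.
set H := (q x - q y) / d.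
have HE : H * d = q x - q y by rewrite /H mulfVK// gt_eqF.
have qlip u v : q u - q v <= mdist u v by exact: lip0_norm1.
have H1 : `|H| <= 1.
  rewrite ler_norml ler_pdivlMr// ler_pdivrMr// mul1r mulN1r qlip lerNl opprB.
  by rewrite /d metric_sym qlip.
pose th := t / 2.
have th0 : 0 < th by rewrite divr_gt0.
pose k := 12 * r / d.
have kE : k * d = 12 * r by rewrite /k mulfVK// gt_eqF.
have k0 : 0 < k by rewrite divr_gt0// mulr_gt0.
have G1 : `|g + th *: (q - H *: g)| <= 1 + th * k.
  apply: lip0_bound; first by rewrite addr_ge0// mulr_ge0// ltW.
  move=> u v; rewrite !(lip0D, lip0Z, lip0N).
  have -> : g u + th * (q u - H * g u) - (g v + th * (q v - H * g v)) =
      (g u - g v) + th * ((q u - q v) - H * (g u - g v)) by ring.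
  have D0 := mdist_ge0 u v.
  have thk := mulr_ge0 (mulr_ge0 (ltW th0) (ltW k0)) D0.
  have [guv|[ux vy]] := g'near u v.
    have Hg : - (H * (g u - g v)) <= mdist u v.
      rewrite (le_trans (ler_norm _))// normrN normrM -[leRHS]mul1r ler_pM//.
      by rewrite (le_trans (lip0_le _ _ _))// ler_piMl.
    have H2 : th * (q u - q v - H * (g u - g v)) <= th * (2 * mdist u v).
      by rewrite ler_pM2l//; have := qlip u v; lra.
    rewrite -gB in guv; have thE : th * 2 = t by rewrite /th mulfVK.
    have : th * 2 * mdist u v = t * mdist u v by rewrite thE.
    by lra.
  have guv : g u - g v <= mdist u v by rewrite gB.
  have gd : `|(g u - g v) - d| <= 4 * r.
    have ux1 := lip0_norm1 u x g1; have ux2 := lip0_norm1 x u g1.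
    have vy1 := lip0_norm1 v y g1; have vy2 := lip0_norm1 y v g1.
    rewrite (metric_sym x u) in ux2; rewrite (metric_sym y v) in vy2.
    have tr : 2 * t * r <= 2 * r by rewrite ler_pM2r//; lra.
    have tr0 := mulr_ge0 (ltW t0) (ltW r0).
    have gxy := gB x y; rewrite g'xy -/d in gxy.
    by rewrite ler_norml; lra.
  have HD : - (H * (g u - g v - d)) <= 4 * r.
    by rewrite (le_trans (ler_norm _))// normrN normrM -[leRHS]mul1r ler_pM.
  have qD : q u - q v <= H * d + 2 * r.
    have := qlip u x; have := qlip y v; rewrite (metric_sym y v) HE.
    by lra.
  have dD : d <= 2 * mdist u v.
    have := metric_triangle x u y; have := metric_triangle u v y.
    rewrite (metric_sym x u) -/d; lra.
  have H2 : th * (q u - q v - H * (g u - g v)) <= th * (k * mdist u v).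
    rewrite ler_pM2l//.
    by have := ler_wpM2l (ltW k0) dD; rewrite kE; lra.
  by lra.
have xiG : free_val xi (g + th *: (q - H *: g)) =
    free_val xi g + th * (free_val xi q - H * free_val xi g).
  by rewrite linearD linearZ linearB linearZ.
have := le_trans (ler_norm _) (free_eval_le xi (g + th *: (q - H *: g))).
rewrite xiG; set a := free_val xi g; set b := free_val xi q.
move=> /le_trans/(_ (ler_pM _ _ Bxi G1)); rewrite mul1r.
move=> /(_ (normr_ge0 _) (normr_ge0 _)) main.
have a1 : a <= 1.
  by rewrite (le_trans (ler_norm _))// (le_trans (free_eval_le1 _ g1)).
have Ha : H * (a - 1) <= sg.
  rewrite (le_trans (ler_norm _))// normrM -[leRHS]mul1r ler_pM//.
  by rewrite ler_norml; lra.
have main' : th * (b - H * a) <= th * (8 * r / d + k).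
  have -> : th * (8 * r / d + k) = sg + th * k.
    by rewrite /th /sg; field; rewrite gt_eqF.
  by lra.
rewrite ler_pM2l// in main'.
have sgr : sg <= 4 * r / d.
  by rewrite ler_pM2r ?invr_gt0// ler_pM2r// ler_piMr.
have : 24 * r / d <= e / 2 by rewrite ler_pdivrMr//; lra.
by rewrite /k in main'; move: main' sgr Ha; lra.
Qed.

End denting.

(** * Short molecules contribute nothing on the sphere *)

(** The pairs are treated one after the other, by composition with a soft
threshold: shrink the interval of radius s around the value c at one point of the
pair to the single value c, and translate the rest of the line by s.  This map is
1-Lipschitz, so the Lipschitz constant does not grow, and equalities obtained
earlier survive.  The cost is at most eta for every N. *)
Lemma flatten_pairs (R : realType) (M : metricType R) (f : M -> R) (u v : nat -> M)
    (eta : R) :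
  (forall x y, f x - f y <= mdist x y) ->
  (forall n, mdist (u n) (v n) <= eta / 2 ^+ n.+1) ->
  forall N, exists g : M -> R,
  [/\ forall x y, g x - g y <= mdist x y,
      forall n, (n < N)%N -> g (u n) = g (v n) &
      forall x, `|g x - f x| <= eta * (1 - 2 ^- N)].
Proof.
move=> flip uv; elim=> [|N [g [glip guv gf]]].
  by exists f; split => // x; rewrite expr0 invr1 !subrr mulr0 normr0.
pose s := eta / 2 ^+ N.+1.
have s0 : 0 <= s by rewrite (le_trans _ (uv N))// mdist_ge0.
pose c := g (u N).
pose phi (w : R) := w - Num.max (- s) (Num.min s (w - c)).
have phi_mono w w' : w <= w' -> 0 <= phi w' - phi w <= w' - w.
  rewrite /phi /Num.max /Num.min => ww'.
  by do !case: ifP => /negP; rewrite -?leNgt; lra.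
have phi_s w : `|phi w - w| <= s.
  rewrite /phi /Num.max /Num.min ler_norml.
  by do !case: ifP => /negP; rewrite -?leNgt; lra.
have phi_c w : `|w - c| <= s -> phi w = c.
  rewrite /phi /Num.max /Num.min ler_norml => /andP[].
  by do !case: ifP => /negP; rewrite -?leNgt; lra.
exists (phi \o g); split => [x y|n|x] /=.
- have [gxy|/ltW gyx] := leP (g x) (g y).
    have /andP[H _] := phi_mono _ _ gxy; have := mdist_ge0 x y.
    by move: H; lra.
  have /andP[_ H] := phi_mono _ _ gyx; have := glip x y.
  by move: H; lra.
- rewrite ltnS leq_eqVlt => /orP[/eqP ->|nN]; last by rewrite guv.
  rewrite !phi_c// ?subrr ?normr0// (le_trans _ (uv N))// ler_norml.
  have := glip (u N) (v N); have := glip (v N) (u N).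
  by rewrite (metric_sym (v N)) /c; lra.
- have := ler_normD (phi (g x) - g x) (g x - f x).
  have -> : phi (g x) - g x + (g x - f x) = phi (g x) - f x by ring.
  have -> : eta * (1 - 2 ^- N.+1) = s + eta * (1 - 2 ^- N).
    have : 2 ^+ N != 0 :> R by rewrite expf_neq0// pnatr_eq0.
    by rewrite /s exprS; move: (2 ^+ N) => k k0; field.
  by move=> /le_trans; apply; exact: lerD.
Qed.

Section cones.
Context (R : realType) (X : normedModType R) (E : set X).

(** Membership of q in the set w E, read as {0} for w = 0 even when E is empty. *)
Definition dilate (w : R) (q : X) :=
  (w = 0 /\ q = 0) \/ (0 <= w /\ exists2 q', E q' & q = w *: q').

Lemma dilateZ (t w : R) q : 0 <= t -> dilate w q -> dilate (t * w) (t *: q).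
Proof.
move=> t0 [[-> ->]|[w0 [q' Eq' ->]]]; first by left; rewrite mulr0 scaler0.
by right; rewrite mulr_ge0//; split => //; exists q' => //; rewrite scalerA.
Qed.

Lemma dilateD (w1 w2 : R) q1 q2 : is_convex E -> dilate w1 q1 -> dilate w2 q2 ->
  dilate (w1 + w2) (q1 + q2).
Proof.
move=> E_convex [[-> ->]|[w10 [x1 Ex1 ->]]]; first by rewrite !add0r.
move=> [[-> ->]|[w20 [x2 Ex2 ->]]].
  by rewrite !addr0; right; split => //; exists x1.
right; split; first exact: addr_ge0.
have [w0|w0] := eqVneq (w1 + w2) 0.
  move/eqP: (w0); rewrite paddr_eq0// => /andP[/eqP -> /eqP ->].
  by exists x1 => //; rewrite addr0 !scale0r addr0.
have wp : 0 < w1 + w2 by rewrite lt_neqAle eq_sym w0 addr_ge0.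
exists (w1 / (w1 + w2) *: x1 + (1 - w1 / (w1 + w2)) *: x2).
  apply: E_convex => //; first by rewrite divr_ge0// ltW.
  by rewrite ler_pdivrMr// mul1r lerDl.
rewrite scalerDr !scalerA; congr (_ *: _ + _ *: _); by field.
Qed.

End cones.

Section sphere.
Context (R : realType) (M : metricType R) (x0 : M).
Notation F := (Free x0).

(** The alternative that drives the proof: a slice of the ball without
arbitrarily short molecules contains a denting molecule. *)
Lemma slice_dichotomy (a b : M) (S : set F) (s : R) :
  complete_space M -> a != b -> 0 < s -> is_slice (unit_ball F) S ->
  (exists2 xi, dent (unit_ball F) xi & S xi) \/
  (exists u v, mdist u v < s /\ S (molecule x0 u v)).
Proof.
move=> M_complete ab s0 sS; have [[xi Sxi] _] := sS.
have [phi [c SE]] := slice_halfspace sS.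
have [f fE] := dual_free_eval phi.
have Sm u v : u != v -> c * mdist u v < f u - f v -> S (molecule x0 u v).
  move=> uv cuv; rewrite SE; split; first exact: molecule_ball.
  by rewrite fE molecule_eval ltr_pdivlMr// mdist_gt0.
have [u [v [uv cuv]]] : exists u v, u != v /\ c * mdist u v < f u - f v.
  apply: contrapT => H.
  have fc u v : f u - f v <= c * mdist u v.
    have [->|uv] := eqVneq u v; first by rewrite subrr mdistxx mulr0.
    by rewrite leNgt; apply/negP => ?; apply: H; exists u, v.
  have c0 : 0 <= c.
    have d0 : 0 < mdist a b by rewrite mdist_gt0.
    rewrite -(pmulr_lge0 _ d0).
    by have := fc a b; have := fc b a; rewrite (metric_sym b a); lra.
  move: Sxi; rewrite SE => -[Bxi]; rewrite fE ltNge => /negP; apply.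
  rewrite (le_trans (ler_norm _))// (le_trans (free_eval_le _ _))//.
  by rewrite -[leRHS]mul1r ler_pM// lip0_bound.
have [[u' [v' H]]|nos] :=
    pselect (exists u v, mdist u v < s /\ S (molecule x0 u v)).
  by right; exists u', v'.
left; have [||x [y [xy cxy crit]]] :=
    @isolated_steep_pair R M f `|f| c s u v M_complete (normr_ge0 f) s0 _ _ uv cuv.
- by move=> x y; rewrite (le_trans (ler_norm _))// lip0_le.
- move=> x y xy cxy; rewrite leNgt; apply/negP => xys; apply: nos.
  by exists x, y; split => //; exact: Sm.
by exists (molecule x0 x y); [exact: denting_molecule|exact: Sm].
Qed.

Lemma sphere_two_points (mu : F) : `|mu| = 1 -> exists a b : M, a != b.
Proof.
move=> mu1; apply: contrapT => H.
have [|f _ muf] := @free_norming R M x0 mu 2^-1; first by rewrite invr_gt0.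
suff : `|f| <= 0.
  by rewrite normr_le0 => /eqP f0; move: muf; rewrite f0 mu1 linear0; lra.
apply: lip0_bound => // x y; have [->|xy] := eqVneq x y.
  by rewrite subrr mul0r.
by exfalso; apply: H; exists x, y.
Qed.

(** Splitting a convex combination into its short molecules and its denting
points.  The number N bounds the indices of the molecules involved, so that
finitely many flattenings make p vanish. *)
Lemma short_molecules_decomposition (u v : nat -> M) (x : nat -> F) (b : F) :
  (forall n, dent (unit_ball F) (x n) \/ x n = molecule x0 (u n) (v n)) ->
  conv_hull (range x) b ->
  exists (l : R) (p q : F) (N : nat), [/\ 0 <= l, `|p| <= l,
    forall g : Lip0 x0, (forall n, (n < N)%N -> g (u n) = g (v n)) ->
      free_val p g = 0,
    dilate (conv_hull (dent (unit_ball F))) (1 - l) q & b = p + q].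
Proof.
move=> xP; move: b; apply: conv_hull_min.
  move=> b1 b2 t t0 t1 [l [p [q [N [l0 pl pN qE ->]]]]].
  move=> [l' [p' [q' [N' [l'0 p'l' p'N' qE' ->]]]]].
  have t1' : 0 <= 1 - t by rewrite subr_ge0.
  exists (t * l + (1 - t) * l'), (t *: p + (1 - t) *: p'),
    (t *: q + (1 - t) *: q'), (maxn N N'); split.
  - by rewrite addr_ge0// mulr_ge0.
  - rewrite (le_trans (ler_normD _ _))// !normrZ !ger0_norm//.
    by rewrite lerD// ler_wpM2l.
  - move=> g guv; rewrite free_evalD !free_evalZ pN ?p'N' ?mulr0 ?addr0//.
      by move=> n nN; apply: guv; rewrite leq_max nN orbT.
    by move=> n nN; apply: guv; rewrite leq_max nN.
  - have -> : 1 - (t * l + (1 - t) * l') =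
        t * (1 - l) + (1 - t) * (1 - l') by ring.
    by apply: dilateD; [exact: conv_hull_convex|exact: dilateZ|exact: dilateZ].
  - by rewrite !scalerDr addrACA.
move=> _ [n _ <-]; have [dx|->] := xP n.
  exists 0, 0, (x n), 0%N; split; rewrite ?normr0 ?add0r ?subr0//.
  right; split => //; exists (x n); rewrite ?scale1r//.
  exact: sub_conv_hull.
exists 1, (molecule x0 (u n) (v n)), 0, n.+1; split; rewrite ?addr0//.
- exact: molecule_ball.
- by move=> g guv; rewrite molecule_eval guv// subrr mul0r.
- by left; rewrite subrr.
Qed.

(** Pick in each determining slice a denting point or a molecule of length at
most eta / 2 ^ (n + 1).  Then mu is close to a combination c = p + q, where p
collects the short molecules, with total weight l, and q the denting points, with
total weight 1 - l.  A function norming mu, flattened on the short pairs, still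
almost norms mu, but it vanishes at p; hence 1 is almost at most 1 - l, so l is
small and mu is close to the hull of the denting points.  This is where the norm
of mu being 1 matters. *)
Lemma SCD_sphere_dent (mu : F) : complete_space M -> unit_sphere F mu ->
  SCD_points (unit_ball F) mu -> closed_conv (dent (unit_ball F)) mu.
Proof.
rewrite /unit_sphere/= => M_complete mu1 /SCD_pointsP[_ [S [sS dS]]].
have [a [b ab]] := sphere_two_points mu1.
apply/closed_convP => e0 e0_gt0.
(* l will be at most 6 * e, and the total error at most 13 * e *)
pose e := Num.min (e0 / 14) (1 / 12).
have e_gt0 : 0 < e by rewrite lt_min !divr_gt0.
have e_e0 : 14 * e <= e0 by rewrite mulrC -ler_pdivlMr// ge_min lexx.
have e12 : 12 * e <= 1 by rewrite mulrC -ler_pdivlMr// ge_min lexx orbT.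
have [f f1 muf] := free_norming mu e_gt0; rewrite mu1 in muf.
have /closure_normP/(_ e e_gt0)[nu Snu munu] := @free_span_dense R M x0 mu.
have [K K0 KP] := lin_span_dirac_bound Snu.
pose eta := e / (K + 1).
have K1 : 0 < K + 1 by rewrite ltr_wpDl.
have eta0 : 0 < eta by rewrite divr_gt0.
have Keta : K * eta <= e.
  by rewrite /eta mulrA ler_pdivrMr// mulrC ler_pM2l// lerDl.
have /choice[w wP] : forall n : nat, exists w : F * (M * M),
    [/\ S n w.1, mdist w.2.1 w.2.2 <= eta / 2 ^+ n.+1 &
     dent (unit_ball F) w.1 \/ w.1 = molecule x0 w.2.1 w.2.2].
  move=> n; have h0 : 0 < eta / 2 ^+ n.+1 by rewrite divr_gt0// exprn_gt0.
  have [[xi dxi Sxi]|[u [v [uv Suv]]]] := slice_dichotomy M_complete ab h0 (sS n).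
    (* a pair of length 0 imposes no condition on the flattened function *)
    by exists (xi, (x0, x0)); split; rewrite /= ?mdistxx ?ltW//; left.
  by exists (molecule x0 u v, (u, v)); split => //=; [exact: ltW|right].
pose x n := (w n).1; pose u n := (w n).2.1; pose v n := (w n).2.2.
have xB : range x `<=` unit_ball F.
  by move=> _ [n _ <-]; have [Sn _ _] := wP n; exact: is_slice_sub (sS n) _ Sn.
have xS n : range x `&` S n !=set0.
  by exists (x n); split; [exists n|have [] := wP n].
have /closed_convP/(_ e e_gt0)[c cx muc] := dS _ xB xS.
have [|l [p [q [N [l0 pl pN qE cE]]]]] :=
    @short_molecules_decomposition u v x c _ cx.
  by move=> n; have [] := wP n.
have flip y z : f y - f z <= mdist y z by exact: lip0_norm1.
have [|g' [g'lip g'uv g'f]] := flatten_pairs flip (u := u) (v := v) (eta := eta) _ N.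
  by move=> n; have [] := wP n.
have [|g gE g1] := @lip0_exists R M x0 g' 1 ler01.
  by move=> y z; rewrite mul1r.
have gf y : `|(g - f) y| <= 2 * eta.
  have bnd z : `|g' z - f z| <= eta.
    rewrite (le_trans (g'f z))// ler_piMr ?(ltW eta0)// gerDl oppr_le0.
  rewrite lip0D lip0N gE; have := bnd y; have := bnd x0.
  by rewrite lip0_base subr0 !ler_norml; clear; lra.
have nugf : `|free_val nu (g - f)| <= K * (2 * eta) by exact: KP.
have mug := free_eval_le1 (mu - nu) g1.
have muf' := free_eval_le1 (mu - nu) f1.
have cg := free_eval_le1 (mu - c) g1.
have pg : free_val p g = 0.
  by apply: pN => n nN; rewrite !gE g'uv.
have qg : free_val q g <= 1 - l.
  rewrite (le_trans (ler_norm _))// (le_trans (free_eval_le1 _ g1))//.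
  case: qE => [[-> ->]|[l1 [q' Eq' ->]]]; first by rewrite normr0.
  rewrite normrZ ger0_norm// ler_piMr//.
  suff : conv_hull (dent (unit_ball F)) `<=` unit_ball F by apply.
  by apply: conv_hull_min; [exact: unit_ball_convex|move=> ? []].
have le6 : l <= 6 * e.
  have muc' := muc; rewrite cE in cg muc'.
  rewrite !(free_evalD, free_evalN) pg in cg mug muf'.
  have nugf' : free_val nu (g - f) = free_val nu g - free_val nu f.
    by rewrite linearB.
  rewrite nugf' in nugf.
  move: (le_lt_trans cg muc') (le_lt_trans mug munu) (le_lt_trans muf' munu).
  rewrite !ltr_norml; move: nugf; rewrite ler_norml.
  by clear -muf qg Keta e_gt0; lra.
have l_lt1 : l < 1 by clear -le6 e12 e_gt0; lra.
case: qE => [[l1 _]|[l1 [q' Eq' qE']]]; first by exfalso; lra.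
exists q' => //.
have q'1 : `|q'| <= 1.
  suff : conv_hull (dent (unit_ball F)) `<=` unit_ball F by apply.
  by apply: conv_hull_min; [exact: unit_ball_convex|move=> ? []].
have -> : mu - q' = (mu - c) + (p - l *: q').
  rewrite cE qE' scalerBl scale1r opprD opprB -addrA; congr (_ + _).
  by rewrite addrC addrACA subrr add0r addKr.
rewrite (le_lt_trans (ler_normD _ _))//.
have : `|p - l *: q'| <= 2 * l.
  rewrite (le_trans (ler_normB _ _))// normrZ ger0_norm//.
  by have := ler_wpM2l l0 q'1; clear -pl; lra.
by clear -muc le6 e_e0 e_gt0; lra.
Qed.

Lemma ball_sub_closed_conv_sphere (C : set F) (e : F) (mu : F) : `|e| = 1 ->
  unit_sphere F `<=` closed_conv C -> unit_ball F mu -> closed_conv C mu.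
Proof.
move=> e1 SC mu1.
have [x x1 muE] : exists2 x : F, `|x| = 1 & mu = `|mu| *: x.
  have [->|mu0] := eqVneq mu 0; first by exists e; rewrite // normr0 scale0r.
  exists (`|mu|^-1 *: mu).
    by rewrite normrZ normfV normr_id mulVf ?normr_eq0.
  by rewrite scalerA divff ?normr_eq0// scale1r.
have -> : mu = ((1 + `|mu|) / 2) *: x + (1 - (1 + `|mu|) / 2) *: (- x).
  rewrite {1}muE scalerN -scalerBl; congr (_ *: _); lra.
apply: closed_conv_convex.
- by rewrite divr_ge0// addr_ge0.
- by rewrite ler_pdivrMr// mul1r; move: mu1; rewrite /unit_ball/=; lra.
- exact: SC.
- by apply: SC; rewrite /unit_sphere/= normrN.
Qed.

Lemma trivial_space_dent : (forall mu : F, mu = 0) -> dent (unit_ball F) 0.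
Proof.
move=> F0; have B0 : unit_ball F 0 by rewrite /unit_ball/= normr0.
split=> // eps eps0; exists [set y | unit_ball F y /\ -1 < (0 : dual F) y].
have H : -1 < (0 : dual F) 0 by rewrite linear0.
split; [exact: halfspace_slice B0 H|by []|].
by apply/diam_leP => x y _ _; rewrite (F0 x) (F0 y) subrr normr0 ltW.
Qed.


End sphere.

Theorem theorem5p1 (R : realType) (M : metricType R) (x0 : M)
    (M_complete : complete_space M) :
  (forall mu : Free x0, unit_sphere (Free x0) mu ->
    (SCD_points (unit_ball (Free x0)) mu <->
     closed_conv (dent (unit_ball (Free x0))) mu)) /\
  (separable_space M ->
    (SCD_set (unit_ball (Free x0)) <->
     unit_ball (Free x0) = closed_conv (dent (unit_ball (Free x0))))).
Proof.
split=> [mu mu1|sM].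
  split; first exact: SCD_sphere_dent.
  exact: closed_conv_dent_SCD.
split=> [scd|]; last first.
  by have [q dq] := separable_free x0 sM; exact: SCD_set_closed_conv_dent dq.
apply/seteqP; split; last first.
  apply: closed_conv_min; [exact: unit_ball_convex|exact: unit_ball_closed|].
  by move=> ? [].
have [[y /eqP y0]|F0] := pselect (exists y : Free x0, y <> 0); last first.
  have {}F0 (y : Free x0) : y = 0 by apply: contrapT => ?; apply: F0; exists y.
  move=> mu _; rewrite (F0 mu); apply: sub_closed_conv.
  exact: trivial_space_dent.
move=> mu; apply: (@ball_sub_closed_conv_sphere _ _ _ _ (`|y|^-1 *: y)).
  by rewrite normrZ normfV normr_id mulVf ?normr_eq0.
move=> nu nu1; apply: SCD_sphere_dent => //.
by apply: SCD_set_points scd _ _; rewrite /unit_ball/= nu1.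
Qed.
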